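(* Let $s\ge 2$, let $\mathcal{O}\subset\mathbb{R}^s$ be a nonempty open subset, and let $F(\vec u)=f_1(u_1)+\dots+f_s(u_s)$ be a smooth function on $\mathcal{O}$. Let $M:=\mathcal{O}\times\mathbb{R}^{2s}$, with coordinates $(\vec u,\vec t,\vec v)$, where $\vec u=(u_1,\dots,u_s)\in\mathcal{O}$, $\vec t=(t_1,\dots,t_s)\in\mathbb{R}^s$ and $\vec v=(v_1,\dots,v_s)\in\mathbb{R}^s$. Let $g_F$ be the pseudo-Riemannian metric of signature $(2s,s)$ on $M$ whose only non-zero components are, for $1\le i\le s$, $$g_F(\partial_i^u,\partial_i^u)=-2F(\vec u)-2\sum_{k=1}^s u_kt_k,\qquad g_F(\partial_i^u,\partial_i^v)=g_F(\partial_i^v,\partial_i^u)=1,\qquad g_F(\partial_i^t,\partial_i^t)=-1,$$ where $\partial_i^u=\partial/\partial u_i$, $\partial_i^t=\partial/\partial t_i$, $\partial_i^v=\partial/\partial v_i$. Then: 1. $(M,g_F)$ is conformally spacelike Jordan Osserman but not conformally timelike Jordan Osserman. 2. $(M,g_F)$ is conformally spacelike Jordan Ivanov-Petrova. 3. $(M,g_F)$ is neither conformally timelike Jordan Ivanov-Petrova nor conformally mixed Jordan Ivanov-Petrova.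
   Context: A pseudo-Riemannian metric has signature $(p,q)$ if maximal negative definite (timelike) subspaces of each tangent space have dimension $p$ and maximal positive definite (spacelike) subspaces have dimension $q$; put $m=p+q$. A tangent vector $x$ is a unit spacelike (resp. timelike) vector if $g(x,x)=1$ (resp. $g(x,x)=-1$). A subspace is spacelike (resp. timelike) if $g$ restricted to it is positive (resp. negative) definite. A $2$-plane is mixed if $g$ restricted to it is non-degenerate of signature $(1,1)$. Let $\nabla$ be the Levi-Civita connection of $(M,g)$. Set $R(x,y):=\nabla_x\nabla_y-\nabla_y\nabla_x-\nabla_{[x,y]}$ and $R(x,y,z,w):=g(R(x,y)z,w)$. For a basis $\{e_1,\dots,e_m\}$ of $T_PM$, let $g_{ij}=g(e_i,e_j)$ with inverse matrix $g^{ij}$, and set $\rho(x,y):=\sum_{ij}g^{ij}R(x,e_i,e_j,y)$ (Ricci tensor) and $\tau:=\sum_{ij}g^{ij}\rho(e_i,e_j)$ (scalar curvature). The Weyl conformal curvature is $$W(x,y,z,w):=R(x,y,z,w)+\tfrac{1}{(m-1)(m-2)}\tau\{g(x,w)g(y,z)-g(x,z)g(y,w)\}$$ $$-\tfrac{1}{m-2}\{\rho(x,w)g(y,z)+\rho(y,z)g(x,w)-\rho(x,z)g(y,w)-\rho(y,w)g(x,z)\},$$ and the operator $W(x,y)$ is defined by $g(W(x,y)z,w)=W(x,y,z,w)$. The conformal Jacobi operator is $J_W(x):y\mapsto W(y,x)x$. For an oriented spacelike or timelike $2$-plane $\pi$ with oriented orthonormal basis $\{e_1,e_2\}$, set $\mathcal{R}_W(\pi):y\mapsto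 W(e_1,e_2)y$. For an oriented mixed $2$-plane $\pi$ with oriented basis $\{e_1,e_2\}$, set $\mathcal{R}_W(\pi):=|\det(g(e_i,e_j))|^{-1/2}\,W(e_1,e_2)$. These are independent of the choice of basis. $(M,g)$ is conformally spacelike (resp. timelike) Jordan Osserman if for every $P\in M$ the Jordan normal form (i.e. the conjugacy class) of the endomorphism $J_W(x)$ of $T_PM$ is the same for all unit spacelike (resp. timelike) $x\in T_PM$. $(M,g)$ is conformally spacelike (resp. timelike, mixed) Jordan Ivanov-Petrova if for every $P\in M$ the Jordan normal form of the endomorphism $\mathcal{R}_W(\pi)$ of $T_PM$ is the same for all oriented spacelike (resp. timelike, mixed) $2$-planes $\pi\subset T_PM$. In all cases the Jordan normal form is permitted to vary with the point $P$. *)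

(* Defs.v *)
From HB Require Import structures.
From mathcomp Require Import all_boot all_order all_algebra mxred.
From mathcomp Require Import all_classical all_reals all_analysis.
From mathcomp Require Import ring zify.
Import Order.TTheory GRing.Theory Num.Theory.
Import numFieldNormedType.Exports.

Set Implicit Arguments.
Unset Strict Implicit.
Unset Printing Implicit Defensive.

Local Open Scope classical_set_scope.
Local Open Scope ring_scope.

(* Tangent vectors are row vectors of components in the coordinate basis, and
   a matrix A stands for the endomorphism y |-> y *m A. *)

Definition gform {R : realType} {n : nat} (G : 'M[R]_n) (x y : 'rV[R]_n) : R :=
  (x *m G *m y^T) 0 0.

(* Subspaces are row spaces. *)
Definition spacelike {R : realType} {n k : nat} (G : 'M[R]_n)
    (U : 'M[R]_(k, n)) : Prop :=
  forall x : 'rV[R]_n, (x <= U)%MS -> x != 0 -> 0 < gform G x x.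

Definition timelike {R : realType} {n k : nat} (G : 'M[R]_n)
    (U : 'M[R]_(k, n)) : Prop :=
  forall x : 'rV[R]_n, (x <= U)%MS -> x != 0 -> gform G x x < 0.

Definition maximal_subspace {R : realType} {n : nat} (C : 'M[R]_n -> Prop)
    (U : 'M[R]_n) : Prop :=
  C U /\ forall V : 'M[R]_n, C V -> (U <= V)%MS -> (V <= U)%MS.

Definition has_signature {R : realType} {n : nat} (G : 'M[R]_n)
    (p q : nat) : Prop :=
  [/\ forall U, maximal_subspace (timelike G) U -> \rank U = p,
      forall U, maximal_subspace (spacelike G) U -> \rank U = q
    & (p + q)%N = n].

Definition partial {R : realType} {n : nat} (i : 'I_n) (f : 'rV[R]_n -> R)
    : 'rV[R]_n -> R :=
  'D_(delta_mx 0 i) f.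

(* All iterated partial derivatives exist and are continuous on O. *)
Definition smooth_on {R : realType} {n : nat} (O : set 'rV[R]_n)
    (f : 'rV[R]_n -> R) : Prop :=
  forall (l : seq 'I_n) (u : 'rV[R]_n), O u ->
    {for u, continuous (foldr partial f l)} /\
    forall i : 'I_n, derivable (foldr partial f l) u (delta_mx 0 i).

Definition pseudo_riemannian_metric {R : realType} {n : nat}
    (M : set 'rV[R]_n) (g : 'rV[R]_n -> 'M[R]_n) (p q : nat) : Prop :=
  [/\ forall i j, smooth_on M (fun P => g P i j),
      forall P, M P -> (g P)^T = g P
    & forall P, M P -> has_signature (g P) p q].

Section LeviCivita.
Context {R : realType} {n : nat}.
Implicit Types (g : 'rV[R]_n -> 'M[R]_n) (X Y Z : 'rV[R]_n -> 'rV[R]_n).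

Definition christoffel g (k i j : 'I_n) (P : 'rV[R]_n) : R :=
  2^-1 * \sum_l invmx (g P) k l *
    (partial i (fun Q => g Q j l) P + partial j (fun Q => g Q i l) P
     - partial l (fun Q => g Q i j) P).

Definition vf_der X (f : 'rV[R]_n -> R) (P : 'rV[R]_n) : R :=
  \sum_i X P 0 i * partial i f P.

Definition lie_bracket X Y : 'rV[R]_n -> 'rV[R]_n := fun P =>
  \row_k (vf_der X (fun Q => Y Q 0 k) P - vf_der Y (fun Q => X Q 0 k) P).

Definition nabla g X Y : 'rV[R]_n -> 'rV[R]_n := fun P =>
  \row_k (vf_der X (fun Q => Y Q 0 k) P
          + \sum_i \sum_j christoffel g k i j P * X P 0 i * Y P 0 j).

Definition curvature_vf g X Y Z : 'rV[R]_n -> 'rV[R]_n := fun P =>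
  nabla g X (nabla g Y Z) P - nabla g Y (nabla g X Z) P
  - nabla g (lie_bracket X Y) Z P.

End LeviCivita.

Section Weyl.
Context {R : realType} {n : nat}.
Variables (g : 'rV[R]_n -> 'M[R]_n) (P : 'rV[R]_n).
Implicit Types x y z w : 'rV[R]_n.

(* The curvature is tensorial, so tangent vectors at P may be extended to
   vector fields arbitrarily; here with constant components. *)
Definition curvature_op x y z : 'rV[R]_n :=
  curvature_vf g (fun=> x) (fun=> y) (fun=> z) P.

Definition curvature x y z w : R := gform (g P) (curvature_op x y z) w.

Definition ricci x y : R :=
  \sum_i \sum_j invmx (g P) i j * curvature x (delta_mx 0 i) (delta_mx 0 j) y.

Definition scalar_curvature : R :=
  \sum_i \sum_j invmx (g P) i j * ricci (delta_mx 0 i) (delta_mx 0 j).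

Definition weyl x y z w : R :=
  let G := gform (g P) in
  curvature x y z w
  + ((n%:R - 1) * (n%:R - 2))^-1 * scalar_curvature *
      (G x w * G y z - G x z * G y w)
  - (n%:R - 2)^-1 *
      (ricci x w * G y z + ricci y z * G x w
       - ricci x z * G y w - ricci y w * G x z).

Definition weyl_op x y z : 'rV[R]_n :=
  (\row_l weyl x y z (delta_mx 0 l)) *m invmx (g P).

Definition jacobi_weyl x : 'M[R]_n := lin1_mx (fun y => weyl_op y x x).

Definition weyl_mx x y : 'M[R]_n := lin1_mx (weyl_op x y).

Definition gram2 x y : 'M[R]_(1 + 1) :=
  col_mx x y *m g P *m (col_mx x y)^T.

Definition skew_weyl_mixed x y : 'M[R]_n :=
  (Num.sqrt `|\det (gram2 x y)|)^-1 *: weyl_mx x y.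

(* Ordered pairs (x, y) that are oriented bases of oriented 2-planes. *)
Definition spacelike_onb x y : Prop :=
  [/\ gform (g P) x x = 1, gform (g P) y y = 1 & gform (g P) x y = 0].

Definition timelike_onb x y : Prop :=
  [/\ gform (g P) x x = -1, gform (g P) y y = -1 & gform (g P) x y = 0].

Definition mixed_basis x y : Prop :=
  row_free (col_mx x y) /\ has_signature (gram2 x y) 1 1.

End Weyl.

Definition same_jordan_form {R : realType} {n : nat} (A B : 'M[R]_n) : Prop :=
  similar_in unitmx A B.

Section Conformal.
Context {R : realType} {n : nat}.
Variables (M : set 'rV[R]_n) (g : 'rV[R]_n -> 'M[R]_n).

Definition conformally_spacelike_jordan_osserman : Prop :=
  forall P, M P -> forall x x' : 'rV[R]_n,
    gform (g P) x x = 1 -> gform (g P) x' x' = 1 ->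
    same_jordan_form (jacobi_weyl g P x) (jacobi_weyl g P x').

Definition conformally_timelike_jordan_osserman : Prop :=
  forall P, M P -> forall x x' : 'rV[R]_n,
    gform (g P) x x = -1 -> gform (g P) x' x' = -1 ->
    same_jordan_form (jacobi_weyl g P x) (jacobi_weyl g P x').

Definition conformally_spacelike_jordan_ivanov_petrova : Prop :=
  forall P, M P -> forall x y x' y' : 'rV[R]_n,
    spacelike_onb g P x y -> spacelike_onb g P x' y' ->
    same_jordan_form (weyl_mx g P x y) (weyl_mx g P x' y').

Definition conformally_timelike_jordan_ivanov_petrova : Prop :=
  forall P, M P -> forall x y x' y' : 'rV[R]_n,
    timelike_onb g P x y -> timelike_onb g P x' y' ->
    same_jordan_form (weyl_mx g P x y) (weyl_mx g P x' y').

Definition conformally_mixed_jordan_ivanov_petrova : Prop :=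
  forall P, M P -> forall x y x' y' : 'rV[R]_n,
    mixed_basis g P x y -> mixed_basis g P x' y' ->
    same_jordan_form (skew_weyl_mixed g P x y) (skew_weyl_mixed g P x' y').

End Conformal.

(* Coordinates are ordered (u, t, v), as R^s x (R^s x R^s). *)
Section Metric.
Context {R : realType} {s : nat}.
Implicit Type P : 'rV[R]_(s + (s + s)).

Definition ucoord P : 'rV[R]_s := lsubmx P.
Definition tcoord P : 'rV[R]_s := lsubmx (rsubmx P).

Definition manifold (O : set 'rV[R]_s) : set 'rV[R]_(s + (s + s)) :=
  [set P | O (ucoord P)].

Definition guu (F : 'rV[R]_s -> R) P : R :=
  - 2 * F (ucoord P) - 2 * \sum_k ucoord P 0 k * tcoord P 0 k.

Definition gF (F : 'rV[R]_s -> R) P : 'M[R]_(s + (s + s)) :=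
  block_mx (guu F P)%:M        (row_mx 0 1%:M)
           (col_mx 0 1%:M)     (block_mx (- 1%:M) 0
                                         0        0).

End Metric.

Section SignatureTheory.
Context {R : realType} {n : nat}.
Implicit Types (G : 'M[R]_n) (x y z : 'rV[R]_n).

Lemma gformC G x y : G^T = G -> gform G x y = gform G y x.
Proof.
move=> Gsym; rewrite /gform -[LHS](mxE trmx_key (fun i j => (x *m G *m y^T) j i)).
by rewrite -/(trmx _) !trmx_mul trmxK Gsym mulmxA.
Qed.

Lemma gformDl G x y z : gform G (x + y) z = gform G x z + gform G y z.
Proof. by rewrite /gform !mulmxDl mxE. Qed.

Lemma gformDr G x y z : gform G z (x + y) = gform G z x + gform G z y.
Proof. by rewrite /gform linearD mulmxDr mxE. Qed.

Lemma gformZl G c x y : gform G (c *: x) y = c * gform G x y.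
Proof. by rewrite /gform -!scalemxAl mxE. Qed.

Lemma gformZr G c x y : gform G x (c *: y) = c * gform G x y.
Proof. by rewrite /gform linearZ /= -!scalemxAr mxE. Qed.

Lemma gformN G x y : gform (- G) x y = - gform G x y.
Proof. by rewrite /gform mulmxN mulNmx mxE. Qed.

Lemma timelikeN G k (U : 'M[R]_(k, n)) : timelike (- G) U <-> spacelike G U.
Proof.
by split=> h x xU x0; move: (h x xU x0); rewrite gformN oppr_lt0.
Qed.

Lemma spacelikeN G k (U : 'M[R]_(k, n)) : spacelike (- G) U <-> timelike G U.
Proof.
by split=> h x xU x0; move: (h x xU x0); rewrite gformN oppr_gt0.
Qed.

Let maximal_timelike_rank G (p q k l : nat) (N : 'M[R]_(k, n))
    (S : 'M[R]_(l, n)) (U : 'M[R]_n) : G^T = G ->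
  timelike G N -> spacelike G S -> \rank N = p -> \rank S = q ->
  (p + q)%N = n -> maximal_subspace (timelike G) U -> \rank U = p.
Proof.
move=> Gsym tN sS rN rS pqn [tU maxU].
have US0 : \rank (U :&: S)%MS = 0%N.
  apply/eqP; rewrite mxrank_eq0; apply/negP => /negP /rowV0Pn [x].
  rewrite sub_capmx => /andP[xU xS] x0.
  by have := lt_trans (tU x xU x0) (sS x xS x0); rewrite ltxx.
have rUp : (\rank U <= p)%N.
  have := mxrank_sum_cap U S; rewrite US0 addn0 rS => e.
  have := rank_leq_col (U + S)%MS; lia.
apply/eqP; rewrite eqn_leq rUp leqNgt; apply/negP => Up.
pose K := kermx (G *m U^T).
have rK : (n <= \rank K + \rank U)%N.
  rewrite mxrank_ker; have := mxrankM_maxr G U^T; rewrite mxrank_tr. move: (\rank (G *m U^T)) (\rank U)=> a b. lia.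
have : (K :&: N)%MS != 0.
  rewrite -mxrank_eq0 -lt0n.
  have := mxrank_sum_cap K N; rewrite rN => e.
  have := rank_leq_col (K + N)%MS; lia.
move=> /rowV0Pn [x]; rewrite sub_capmx => /andP[/sub_kermxP xK xN] x0.
have Gxx := tN x xN x0.
have Gxu u : (u <= U)%MS -> gform G x u = 0.
  by move=> /submxP [D ->]; rewrite /gform trmx_mul !mulmxA -(mulmxA x) xK mul0mx mxE.
have xU : (x <= U)%MS.
  apply: (submx_trans (addsmxSr U x)); apply: maxU; last exact: addsmxSl.
  move=> y /sub_addsmxP[[D1 D2] /= ->].
  have uU : (D1 *m U <= U)%MS by rewrite submxMl.
  rewrite [D2]mx11_scalar mul_scalar_mx => y0.
  rewrite gformDl !gformDr !gformZl !gformZr [gform G (_ *m _) x]gformC//.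
  rewrite Gxu// mulr0 addr0 add0r.
  have [uv0|u0] := eqVneq (D1 *m U) 0.
    move: y0; rewrite uv0 add0r scaler_eq0 negb_or => /andP[c0 _].
    rewrite {1}/gform !mul0mx mxE add0r mulrA -expr2.
    by rewrite pmulr_rlt0// lt0r sqrf_eq0 c0 sqr_ge0.
  apply: ltr_wnDr; [by rewrite mulrA -expr2 mulr_ge0_le0 ?sqr_ge0// ltW|exact: tU].
by move: Gxx; rewrite Gxu// ltxx.
Qed.

Lemma has_signatureP G (p q k l : nat) (N : 'M[R]_(k, n)) (S : 'M[R]_(l, n)) :
  G^T = G -> timelike G N -> spacelike G S -> \rank N = p -> \rank S = q ->
  (p + q)%N = n -> has_signature G p q.
Proof.
move=> Gsym tN sS rN rS pqn; split=> // U.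
  exact: maximal_timelike_rank tN sS rN rS pqn.
move=> [sU maxU].
apply: (@maximal_timelike_rank (- G) q p _ _ S N U); rewrite ?linearN/= ?Gsym//.
- exact/timelikeN.
- exact/spacelikeN.
- by rewrite addnC.
- by split=> [|V /timelikeN]; [exact/timelikeN|exact: maxU].
Qed.
End SignatureTheory.


Section MetricSignature.
Context {R : realType} {s : nat}.
Variables (F : 'rV[R]_s -> R) (P : 'rV[R]_(s + (s + s))).

Let sq (k : nat) (x : 'rV[R]_k) : R := (x *m x^T) 0 0.

Let sq_ge0 k (x : 'rV[R]_k) : 0 <= sq x.
Proof. by rewrite /sq mxE sumr_ge0// => i _; rewrite mxE -expr2 sqr_ge0. Qed.

Let sq_eq0 k (x : 'rV[R]_k) : (sq x == 0) = (x == 0).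
Proof.
apply/idP/idP => [|/eqP->]; last by rewrite /sq mul0mx mxE.
rewrite /sq mxE psumr_eq0 => [/allP h|i _]; last by rewrite mxE -expr2 sqr_ge0.
apply/eqP/rowP => i; have := h i (mem_index_enum _).
by rewrite !mxE -expr2 sqrf_eq0 => /eqP.
Qed.

Lemma gF_sym : (gF F P)^T = gF F P.
Proof.
rewrite /gF !(tr_block_mx, tr_row_mx, tr_col_mx, tr_scalar_mx, trmx0, linearN)/=.
by rewrite tr_scalar_mx.
Qed.

Lemma gF_gform (a b c : 'rV[R]_s) :
  gform (gF F P) (row_mx a (row_mx b c)) (row_mx a (row_mx b c)) =
  guu F P * sq a + 2 * (a *m c^T) 0 0 - sq b.
Proof.
have ca : (c *m a^T) 0 0 = (a *m c^T) 0 0.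
  by rewrite !mxE; apply: eq_bigr => i _; rewrite !mxE mulrC.
rewrite /gform /gF mul_row_block mul_mx_row mul_row_col mul_row_block.
rewrite !mulmx0 !mulmx1 !addr0 add0r mulmxN mulmx1 mul_mx_scalar.
rewrite !tr_row_mx !mul_row_col add_row_mx add0r addr0 mul_row_col.
rewrite mulmxDl -scalemxAl mulNmx mxE [X in X + _]mxE [X in _ + X]mxE.
rewrite [X in X + _ + _]mxE [X in _ + (X + _)]mxE ca /sq; ring.
Qed.

Lemma gF_signature : has_signature (gF F P) (s + s) s.
Proof.
pose lam : R := - (guu F P + 1) / 2.
pose mu : R := (1 - guu F P) / 2.
pose N : 'M[R]_(s + s, s + (s + s)) :=
  col_mx (row_mx 1%:M (row_mx 0 lam%:M)) (row_mx 0 (row_mx 1%:M 0)).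
pose S : 'M[R]_(s, s + (s + s)) := row_mx 1%:M (row_mx 0 mu%:M).
have Nx (D : 'rV[R]_(s + s)) :
    D *m N = row_mx (lsubmx D) (row_mx (rsubmx D) (lam *: lsubmx D)).
  rewrite -{1}[D]hsubmxK mul_row_col !mul_mx_row !mulmx1 !mulmx0 mul_mx_scalar.
  by rewrite !add_row_mx !addr0 !add0r.
have Sx (D : 'rV[R]_s) : D *m S = row_mx D (row_mx 0 (mu *: D)).
  by rewrite !mul_mx_row !mulmx1 !mulmx0 mul_mx_scalar.
apply: (@has_signatureP _ _ _ _ _ _ _ N S) => //; first exact: gF_sym.
- move=> x /submxP[D ->]; rewrite Nx => x0; rewrite gF_gform.
  rewrite linearZ/= -scalemxAr mxE -/(sq _).
  have -> : guu F P * sq (lsubmx D) + 2 * (lam * sq (lsubmx D)) - sq (rsubmx D)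
      = - (sq (lsubmx D) + sq (rsubmx D)) by rewrite /lam; field.
  rewrite oppr_lt0 lt0r addr_ge0// andbT; apply: contra x0.
  by rewrite paddr_eq0// !sq_eq0 => /andP[/eqP-> /eqP->]; rewrite scaler0 !row_mx0.
- move=> x /submxP[D ->]; rewrite Sx => x0; rewrite gF_gform.
  rewrite linearZ/= -scalemxAr mxE -/(sq _).
  have -> : guu F P * sq D + 2 * (mu * sq D) - sq (0 : 'rV[R]_s) = sq D.
    by have -> : sq (0 : 'rV[R]_s) = 0 by [rewrite /sq mul0mx mxE]; rewrite /mu; field.
  rewrite lt0r sq_ge0 andbT sq_eq0; apply: contra x0 => /eqP->.
  by rewrite scaler0 !row_mx0.
- apply/eqP; rewrite -/(row_free N) -kermx_eq0; apply/rowV0P => D /sub_kermxP.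
  rewrite Nx => /eqP; rewrite !row_mx_eq0 => /andP[/eqP l0 /andP[/eqP r0 _]].
  by rewrite -[D]hsubmxK l0 r0 row_mx0.
- apply/eqP; rewrite -/(row_free S) -kermx_eq0; apply/rowV0P => D /sub_kermxP.
  by rewrite Sx => /eqP; rewrite row_mx_eq0 => /andP[/eqP ->].
- by rewrite addnA.
Qed.
End MetricSignature.

Lemma partial_near_eq {R : realType} {n : nat} (M : set 'rV[R]_n)
    (f h : 'rV[R]_n -> R) i P :
  open M -> M P -> (forall Q, M Q -> f Q = h Q) -> partial i f P = partial i h P.
Proof.
move=> oM MP fh; apply: near_eq_derive.
by apply: filterS (open_nbhs_nbhs (conj oM MP)) => Q /fh.
Qed.

Section LeviCivitaTheory.
Context {R : realType} {n : nat}.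
Variables (M : set 'rV[R]_n) (g : 'rV[R]_n -> 'M[R]_n).
Hypotheses (openM : open M) (gsym : forall P, M P -> (g P)^T = g P).
Variable P : 'rV[R]_n.
Hypothesis MP : M P.
Implicit Types X Y Z : 'rV[R]_n -> 'rV[R]_n.

Let gC Q i j : M Q -> g Q i j = g Q j i.
Proof. by move=> MQ; rewrite -{1}(gsym MQ) mxE. Qed.

Let dgC i j k : partial k (fun Q => g Q i j) P = partial k (fun Q => g Q j i) P.
Proof. by apply: partial_near_eq openM MP _ => Q /gC. Qed.

Let christoffelC k i j : christoffel g k i j P = christoffel g k j i P.
Proof.
rewrite /christoffel; congr (_ * _); apply: eq_bigr => l _.
by rewrite [X in _ * (X - _)]addrC (dgC i j).
Qed.

Lemma nabla_torsion_free X Y : nabla g X Y P - nabla g Y X P = lie_bracket X Y P.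
Proof.
apply/rowP => k; rewrite !mxE.
have -> : \sum_i \sum_j christoffel g k i j P * Y P 0 i * X P 0 j =
          \sum_i \sum_j christoffel g k i j P * X P 0 i * Y P 0 j.
  rewrite exchange_big; apply: eq_bigr => i _; apply: eq_bigr => j _.
  by rewrite christoffelC mulrAC.
by rewrite opprD addrACA subrr addr0.
Qed.

Let sum4 (T : 'I_n -> 'I_n -> 'I_n -> 'I_n -> R) :
  \sum_m \sum_i \sum_j \sum_k T m i j k = \sum_k \sum_j \sum_m \sum_i T m i j k.
Proof.
under eq_bigr do under eq_bigr do rewrite exchange_big.
under eq_bigr do rewrite exchange_big.
rewrite exchange_big; apply: eq_bigr => k _ /=.
by under eq_bigr do rewrite exchange_big; rewrite exchange_big.
Qed.

Let sum4' (T : 'I_n -> 'I_n -> 'I_n -> 'I_n -> R) :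
  \sum_m \sum_i \sum_j \sum_k T m i j k = \sum_i \sum_k \sum_m \sum_j T m i j k.
Proof.
rewrite exchange_big; apply: eq_bigr => i _ /=.
by under eq_bigr do rewrite exchange_big; rewrite exchange_big.
Qed.

Hypothesis gunit : g P \in unitmx.

Let christoffel_lower i j m :
  \sum_k christoffel g k i j P * g P k m =
  2^-1 * (partial i (fun Q => g Q j m) P + partial j (fun Q => g Q i m) P
     - partial m (fun Q => g Q i j) P).
Proof.
rewrite /christoffel; set T := (X in _ = _ * X).
pose t := fun l => (partial i (fun Q => g Q j l) P + partial j (fun Q => g Q i l) P
     - partial l (fun Q => g Q i j) P).
transitivity (2^-1 * \sum_l (invmx (g P) *m g P) m l * t l).
  rewrite mulr_sumr.
  under eq_bigr do rewrite mulr_sumr mulr_suml.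
  rewrite exchange_big; apply: eq_bigr => l _ /=.
  have -> : (invmx (g P) *m g P) m l = (g P *m invmx (g P)) m l.
    by rewrite mulmxV// mulVmx.
  rewrite mxE mulr_suml mulr_sumr; apply: eq_bigr => k _.
  rewrite (gC _ _ MP).
  have -> : invmx (g P) k l = invmx (g P) k l by [].
  rewrite -/(t l); ring.
rewrite mulVmx//; congr (_ * _); rewrite (bigD1 m)//= mxE eqxx mul1r big1 ?addr0//.
by move=> l /negPf lm; rewrite mxE eq_sym lm mul0r.
Qed.

Let dmetric i j m : partial m (fun Q => g Q i j) P =
  \sum_k christoffel g k m i P * g P k j + \sum_k christoffel g k m j P * g P k i.
Proof. by rewrite !christoffel_lower (dgC j i m) (dgC m j) (dgC m i); field. Qed.

Lemma nabla_metric X Y Z :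
  (forall i j k, derivable (fun Q => g Q i j) P (delta_mx 0 k)) ->
  (forall i k, derivable (fun Q => Y Q 0 i) P (delta_mx 0 k)) ->
  (forall i k, derivable (fun Q => Z Q 0 i) P (delta_mx 0 k)) ->
  vf_der X (fun Q => gform (g Q) (Y Q) (Z Q)) P =
  gform (g P) (nabla g X Y P) (Z P) + gform (g P) (Y P) (nabla g X Z P).
Proof.
move=> dg dY dZ.
have gE Q x y : gform (g Q) x y = \sum_i \sum_j x 0 i * g Q i j * y 0 j.
  rewrite /gform -mulmxA mxE; apply: eq_bigr => i _.
  rewrite mxE mulr_sumr; apply: eq_bigr => j _.
  by rewrite mxE mulrA.
have dE m : partial m (fun Q => gform (g Q) (Y Q) (Z Q)) P =
    \sum_i \sum_j (partial m (fun Q => Y Q 0 i) P * g P i j * Z P 0 j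
      + Y P 0 i * partial m (fun Q => g Q i j) P * Z P 0 j
      + Y P 0 i * g P i j * partial m (fun Q => Z Q 0 j) P).
  rewrite /partial.
  have -> : (fun Q => gform (g Q) (Y Q) (Z Q)) =
    \sum_i \sum_j ((fun Q => Y Q 0 i) \* (fun Q => g Q i j) \* (fun Q => Z Q 0 j)).
    apply/funext => Q; rewrite gE fct_sumE; apply: eq_bigr => i _.
    by rewrite fct_sumE.
  have dp i j : derivable ((fun Q => Y Q 0 i) \* (fun Q => g Q i j) \*
      (fun Q => Z Q 0 j)) P (delta_mx 0 m).
    apply: derivableM; last exact: dZ.
    by apply: derivableM; [exact: dY|exact: dg].
  rewrite derive_sum; last by move=> i; apply: derivable_sum => j; exact: dp.
  apply: eq_bigr => i _; rewrite derive_sum; last by move=> j; exact: dp.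
  apply: eq_bigr => j _.
  have dYg : derivable ((fun Q => Y Q 0 i) \* (fun Q => g Q i j)) P (delta_mx 0 m).
    by apply: derivableM; [exact: dY|exact: dg].
  rewrite deriveM// deriveM// /GRing.scale/=.
  ring.
pose DY m i := partial m (fun Q => Y Q 0 i) P.
pose DZ m i := partial m (fun Q => Z Q 0 i) P.
pose C m k i := christoffel g k m i P.
have -> : vf_der X (fun Q => gform (g Q) (Y Q) (Z Q)) P =
    \sum_m \sum_i \sum_j X P 0 m * DY m i * g P i j * Z P 0 j
  + \sum_m \sum_i \sum_j \sum_k X P 0 m * Y P 0 i * C m k i * g P k j * Z P 0 j
  + (\sum_m \sum_i \sum_j \sum_k X P 0 m * Y P 0 i * C m k j * g P k i * Z P 0 j
  + \sum_m \sum_i \sum_j X P 0 m * Y P 0 i * g P i j * DZ m j).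
  rewrite -!big_split; apply: eq_bigr => m _ /=; rewrite dE mulr_sumr.
  rewrite -!big_split; apply: eq_bigr => i _ /=; rewrite mulr_sumr.
  rewrite -!big_split; apply: eq_bigr => j _ /=; rewrite dmetric.
  rewrite !(mulrDr, mulrDl) !(mulr_sumr, mulr_suml) -!addrA.
  by congr (_ + (_ + (_ + _))); rewrite /DY /DZ; try ring;
    apply: eq_bigr => k _; rewrite /C; ring.
congr (_ + _).
- rewrite gE.
  transitivity (\sum_i \sum_j (\sum_m X P 0 m * DY m i * g P i j * Z P 0 j
      + \sum_m \sum_k X P 0 m * Y P 0 k * C m i k * g P i j * Z P 0 j)).
    rewrite exchange_big sum4 -big_split; apply: eq_bigr => i _ /=.
    by rewrite exchange_big -big_split.
  apply: eq_bigr => i _; apply: eq_bigr => j _; rewrite mxE !mulrDl.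
  congr (_ + _); first by rewrite /vf_der !mulr_suml.
  rewrite !mulr_suml; apply: eq_bigr => m _.
  by rewrite !mulr_suml; apply: eq_bigr => k _; rewrite /C; ring.
- rewrite gE addrC.
  transitivity (\sum_i \sum_j (\sum_m X P 0 m * Y P 0 i * g P i j * DZ m j
      + \sum_m \sum_k X P 0 m * Y P 0 i * C m j k * g P j i * Z P 0 k)).
    rewrite exchange_big sum4' -big_split; apply: eq_bigr => i _ /=.
    by rewrite exchange_big -big_split.
  apply: eq_bigr => i _; apply: eq_bigr => j _; rewrite mxE mulrDr.
  rewrite (gC _ _ MP); congr (_ + _).
    by rewrite /vf_der !mulr_sumr; apply: eq_bigr => m _; rewrite /DZ; ring.
  rewrite !mulr_sumr; apply: eq_bigr => m _.
  by rewrite !mulr_sumr; apply: eq_bigr => k _; rewrite /C; ring.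
Qed.
End LeviCivitaTheory.

Section MetricSmooth.
Context {R : realType} {s : nat}.
Variables (O : set 'rV[R]_s) (F : 'rV[R]_s -> R).
Hypotheses (openO : open O) (smoothF : smooth_on O F).
Let M := manifold O.

Lemma manifold_open : open M.
Proof.
apply: (@open_comp _ _ ucoord O) => // P _.
exact/differentiable_continuous/differentiable_lsubmx.
Qed.

Inductive smooth_alg : ('rV[R]_(s + (s + s)) -> R) -> Prop :=
| smooth_alg_ext f h : smooth_alg f -> (forall P, M P -> f P = h P) -> smooth_alg h
| smooth_alg_base f : smooth_on O f -> smooth_alg (fun P => f (ucoord P))
| smooth_alg_coord i : smooth_alg (fun P => P 0 i)
| smooth_alg_cst c : smooth_alg (fun=> c)
| smooth_alg_add f h : smooth_alg f -> smooth_alg h -> smooth_alg (fun P => f P + h P)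
| smooth_alg_mul f h : smooth_alg f -> smooth_alg h -> smooth_alg (fun P => f P * h P).

Lemma ucoord_quotient (f : 'rV[R]_s -> R) P v :
  (fun h : R => h^-1 *: ((f \o ucoord \o shift P) (h *: v) - f (ucoord P))) =
  (fun h : R => h^-1 *: ((f \o shift (ucoord P)) (h *: ucoord v) - f (ucoord P))).
Proof.
apply/funext => h /=; congr (_ *: (f _ - _)); apply/rowP => j.
by rewrite !mxE.
Qed.

Lemma ucoord_delta (i : 'I_(s + (s + s))) :
  ucoord (delta_mx 0 i : 'rV[R]__) =
  match fintype.split i with inl j => delta_mx 0 j | inr _ => 0 end.
Proof.
apply/rowP => j; rewrite !mxE eqxx /=; case: splitP => k ik; rewrite mxE ?eqxx //=.
  by congr (_%:R); rewrite -!val_eqE /= ik.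
by rewrite -val_eqE /= ik; case: eqP => // e; have := ltn_ord j; rewrite e; lia.
Qed.

Lemma smooth_algP f : smooth_alg f -> forall P, M P ->
  {for P, continuous f} /\ forall i, derivable f P (delta_mx 0 i).
Proof.
elim=> {f} [f h _ IH fh|f sf|i|c|f h _ IHf _ IHh|f h _ IHf _ IHh] P MP.
- have [cf df] := IH _ MP.
  have nfh : \forall Q \near P, f Q = h Q.
    by apply: filterS (open_nbhs_nbhs (conj manifold_open MP)) => Q /fh.
  split=> [|i]; last exact: near_eq_derivable nfh (df i).
  have hf : h x @[x --> P] --> f P := cvg_trans (near_eq_cvg nfh) cf.
  by move: hf; rewrite (fh _ MP); apply.
- have [cf df] := sf [::] _ MP; split=> [|i].
    apply: continuous_comp cf.
    exact/differentiable_continuous/differentiable_lsubmx.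
  rewrite /derivable ucoord_quotient ucoord_delta.
  case: fintype.split => [j|_]; first exact: df.
  exact: derivable0.
- have dc := differentiable_coord P 0 i.
  by split=> [|j]; [exact: differentiable_continuous dc|exact: diff_derivable].
- by split=> [|i]; [exact: cst_continuous|exact: derivable_cst].
- have [cf df] := IHf _ MP; have [ch dh] := IHh _ MP.
  by split=> [|i]; [exact: continuousD|exact: derivableD].
- have [cf df] := IHf _ MP; have [ch dh] := IHh _ MP.
  by split=> [|i]; [exact: continuousM|exact: derivableM].
Qed.

Lemma smooth_alg_partial f i : smooth_alg f -> smooth_alg (partial i f).
Proof.
elim=> {f} [f h sf IH fh|f sf|j|c|f h sf IHf sh IHh|f h sf IHf sh IHh].
- by apply: smooth_alg_ext IH _ => P MP; apply: partial_near_eq fh => //; exact: manifold_open.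
- rewrite (_ : partial i _ = fun P => 'D_(ucoord (delta_mx 0 i)) f (ucoord P)).
    rewrite ucoord_delta; case: fintype.split => [j|_].
      apply: (smooth_alg_base (f := partial j f)) => l; have := sf (rcons l j).
      by rewrite foldr_rcons.
    by under eq_fun do rewrite derive0; exact: smooth_alg_cst.
  by apply/funext => P; rewrite /partial /derive ucoord_quotient.
- apply: smooth_alg_ext (smooth_alg_cst ((delta_mx 0 i : 'rV[R]_(s + (s + s))) 0 j)) _ => P _.
  have /matrixP/(_ 0 j) := derive_mx (@derivable_id _ _ P (delta_mx 0 i)).
  by rewrite derive_id [RHS]mxE => ->.
- by apply: smooth_alg_ext (smooth_alg_cst 0) _ => P _; rewrite /partial derive_cst.
- apply: smooth_alg_ext (smooth_alg_add IHf IHh) _ => P MP.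
  by rewrite /partial deriveD//; [exact: (smooth_algP sf MP).2|exact: (smooth_algP sh MP).2].
- apply: smooth_alg_ext (smooth_alg_add (smooth_alg_mul sf IHh) (smooth_alg_mul sh IHf)) _ => P MP.
  by rewrite /partial deriveM//; [exact: (smooth_algP sf MP).2|exact: (smooth_algP sh MP).2].
Qed.

Lemma smooth_alg_smooth f : smooth_alg f -> smooth_on M f.
Proof.
move=> sf l P MP; apply: smooth_algP MP.
by elim: l => //= i l; exact: smooth_alg_partial.
Qed.

Lemma smooth_alg_gF i j : smooth_alg (fun P => gF F P i j).
Proof.
have sg : smooth_alg (guu F).
  have ss : smooth_alg (fun P => \sum_k ucoord P 0 k * tcoord P 0 k).
    have sr (r : seq 'I_s) : smooth_alg (fun P => \sum_(k <- r) ucoord P 0 k * tcoord P 0 k).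
      elim: r => [|k r IH]; first by under eq_fun do rewrite big_nil; exact: smooth_alg_cst.
      under eq_fun do rewrite big_cons; apply: smooth_alg_add IH.
      by apply: smooth_alg_mul; under eq_fun do rewrite !mxE; exact: smooth_alg_coord.
    exact: sr.
  have sF := smooth_alg_mul (smooth_alg_cst (-2)) (smooth_alg_base smoothF).
  apply: smooth_alg_ext (smooth_alg_add sF (smooth_alg_mul (smooth_alg_cst (-2)) ss)) _ => P _.
  by rewrite /guu -[X in _ = _ + X]mulNr.
case: (fintype.splitP i) => a ia.
  have -> : i = lshift _ a by exact/val_inj.
  case: (fintype.splitP j) => b jb.
    have -> : j = lshift _ b by exact/val_inj.
    under eq_fun do rewrite block_mxEul mxE.
    case: (a == b); last by under eq_fun do rewrite mulr0n; exact: smooth_alg_cst.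
    by under eq_fun do rewrite mulr1n; exact: sg.
  have -> : j = rshift _ b by exact/val_inj.
  by under eq_fun do rewrite block_mxEur; exact: smooth_alg_cst.
have -> : i = rshift _ a by exact/val_inj.
case: (fintype.splitP j) => b jb.
  have -> : j = lshift _ b by exact/val_inj.
  by under eq_fun do rewrite block_mxEdl; exact: smooth_alg_cst.
have -> : j = rshift _ b by exact/val_inj.
by under eq_fun do rewrite block_mxEdr; exact: smooth_alg_cst.
Qed.

Lemma gF_pseudo_riemannian_metric :
  pseudo_riemannian_metric (manifold O) (gF F) (s + s) s.
Proof.
split=> [i j|P _|P _]; first exact/smooth_alg_smooth/smooth_alg_gF.
  exact: gF_sym.
exact: gF_signature.
Qed.
End MetricSmooth.

(* Main.v *)
Require Import Defs.
From HB Require Import structures.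
From mathcomp Require Import all_boot all_order all_algebra mxred.
From mathcomp Require Import all_classical all_reals all_analysis.
From mathcomp Require Import ring.
Import Order.TTheory GRing.Theory Num.Theory.
Import numFieldNormedType.Exports.

Set Implicit Arguments.
Unset Strict Implicit.
Unset Printing Implicit Defensive.

Local Open Scope classical_set_scope.
Local Open Scope ring_scope.

(** Write a tangent vector as [x = (a, b, c)] in the [u], [t] and [v]
    directions, and let [H] be the Hessian of [F] at [u], which is symmetric
    because [F] is separable. The only non-constant entry of the metric is
    [guu], so covariant derivatives of constant fields are given in closed form
    by the gradient of [F], [u] and [t] ([nabla_cst]); differentiating once
    more gives the curvature operator ([curvature_opE]): [R(x, y) z] has no [u]
    component, and its [t] and [v] components are
    [[
      z_u K   and   z_u (wedge w a + wedge a' w') - z_t K,   K = wedge a a',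
    ]]
    where [a], [a'] are the [u] components of [x], [y], [wedge p q] is the skew
    map [z |-> <z, p> q - <z, q> p], and [w], [w'] depend on [y], [x] only.
    Every term of the contraction defining the Ricci tensor vanishes
    ([ricci_eq0]), so the Weyl tensor is the curvature tensor.

    Hence both operators in question are of the form
    [[
      nil3 A B C = [0 A B; 0 0 C; 0 0 0].
    ]]
    The skew-symmetric operator of [x, y] has [A = K] and [C = - K]
    ([weyl_mxE]); the Jacobi operator of [x] has [A = - perp a] and
    [C = perp a], where [perp a] is [|a|^2] times the orthogonal projection to
    the complement of [a] ([jacobi_weylE]). In both cases [B] lies in
    [Y C + A X] and can be removed by a unipotent change of basis
    ([nil3_perp_reduce], [nil3_wedge_reduce]), as soon as [a] is nonzero,
    respectively [a] and [a'] are independent. What is left depends, up to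
    scalars that can be absorbed, on a line or a plane of the Euclidean space
    [R^s]; the orthogonal group permutes these transitively, so all such
    operators are similar ([nil3_perp_similar], [nil3_wedge_similar]).

    A vector with [a = 0] has square norm [- |b|^2 <= 0], so [a] is nonzero for
    spacelike [x], and [a], [a'] are independent when [x], [y] span a spacelike
    plane. This gives the positive assertions. For the negative ones, the
    operator vanishes at the timelike vector [d/dt_0], at the timelike plane of
    [d/dt_0], [d/dt_1] and at the mixed plane spanned by [d/dt_0] and a
    spacelike vector with [u] component [e_0], while timelike vectors and planes
    with independent nonzero [u] components, and the mixed plane in which
    [d/dt_1] replaces [d/dt_0], give nonzero operators. *)

(** * The Euclidean inner product, reflections and wedge products *)

Section DotProduct.
Context {R : rcfType} {n : nat}.
Implicit Types (a b p q u v w : 'rV[R]_n) (A O : 'M[R]_n).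

(** The standard Euclidean inner product. *)
Definition dotp u v : R := (u *m v^T) 0 0.

Lemma dotpE u v : dotp u v = \sum_i u 0 i * v 0 i.
Proof. by rewrite /dotp mxE; apply: eq_bigr => i _; rewrite mxE. Qed.

Lemma dotpC u v : dotp u v = dotp v u.
Proof. by rewrite !dotpE; apply: eq_bigr => i _; rewrite mulrC. Qed.

Lemma dotpDl u v w : dotp (u + v) w = dotp u w + dotp v w.
Proof. by rewrite /dotp mulmxDl mxE. Qed.

Lemma dotpZl c u v : dotp (c *: u) v = c * dotp u v.
Proof. by rewrite /dotp -scalemxAl mxE. Qed.

Lemma dotpNl u v : dotp (- u) v = - dotp u v.
Proof. by rewrite /dotp mulNmx mxE. Qed.

Lemma dotpDr u v w : dotp w (u + v) = dotp w u + dotp w v.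
Proof. by rewrite !(dotpC w) dotpDl. Qed.

Lemma dotpZr c u v : dotp v (c *: u) = c * dotp v u.
Proof. by rewrite !(dotpC v) dotpZl. Qed.

Lemma dotpNr u v : dotp v (- u) = - dotp v u.
Proof. by rewrite !(dotpC v) dotpNl. Qed.

Lemma dotp0l u : dotp 0 u = 0.
Proof. by rewrite /dotp mul0mx mxE. Qed.

Lemma dotp0r u : dotp u 0 = 0.
Proof. by rewrite dotpC dotp0l. Qed.

Definition dotp_bilin :=
  (dotpDl, dotpDr, dotpNl, dotpNr, dotpZl, dotpZr, dotp0l, dotp0r).

Lemma dotp_delta_r u i : dotp u (delta_mx 0 i) = u 0 i.
Proof. by rewrite /dotp trmx_delta -colE mxE. Qed.

Lemma dotp_ge0 u : 0 <= dotp u u.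
Proof. by rewrite dotpE sumr_ge0// => i _; rewrite -expr2 sqr_ge0. Qed.

Lemma dotp_eq0 u : (dotp u u == 0) = (u == 0).
Proof.
apply/idP/idP => [|/eqP->]; last by rewrite dotp0l.
rewrite dotpE psumr_eq0 => [/allP h|i _]; last by rewrite -expr2 sqr_ge0.
apply/eqP/rowP => i; have := h i (mem_index_enum _).
by rewrite !mxE -expr2 sqrf_eq0 => /eqP.
Qed.

Lemma mulmx_outer u v w : u *m (v^T *m w) = dotp u v *: w.
Proof. by rewrite mulmxA [u *m v^T]mx11_scalar mul_scalar_mx. Qed.

Lemma outer_mulmx u v w : u^T *m v *m w^T = dotp v w *: u^T.
Proof. by rewrite -mulmxA [v *m w^T]mx11_scalar mul_mx_scalar. Qed.

(** The reflection in the hyperplane orthogonal to [w]; the identity when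
    [w = 0]. *)
Definition reflection w : 'M[R]_n := 1%:M - (2 / dotp w w) *: (w^T *m w).

Lemma mulmx_reflection u w :
  u *m reflection w = u - (2 / dotp w w * dotp u w) *: w.
Proof. by rewrite mulmxBr mulmx1 -scalemxAr mulmx_outer scalerA. Qed.

Lemma reflection_sym w : (reflection w)^T = reflection w.
Proof. by rewrite /reflection linearB /= trmx1 linearZ /= trmx_mul trmxK. Qed.

Lemma reflection_orthogonal w : (reflection w)^T *m reflection w = 1%:M.
Proof.
rewrite reflection_sym; apply/row_matrixP => i; rewrite !rowE mulmxA mulmx1.
have [->|w0] := eqVneq w 0; first by rewrite !mulmx_reflection !scaler0 !subr0.
have ww : dotp w w != 0 by rewrite dotp_eq0.
rewrite !mulmx_reflection !dotp_bilin -addrA -opprD -scalerDl.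
set c := (X in X *: w); have -> : c = 0 by rewrite /c; field.
by rewrite scale0r subr0.
Qed.

Lemma reflection_unit w : reflection w \in unitmx.
Proof. by have [] := mulmx1_unit (reflection_orthogonal w). Qed.

Lemma reflection_swap p q : dotp p p = dotp q q -> p *m reflection (p - q) = q.
Proof.
move=> pq; have [/eqP|w0] := eqVneq (p - q) 0.
  by rewrite subr_eq0 => /eqP->; rewrite mulmx_reflection subrr scaler0 subr0.
have e : dotp (p - q) (p - q) = 2 * dotp p (p - q).
  by rewrite !dotp_bilin -pq (dotpC q p); ring.
rewrite mulmx_reflection; have := w0; rewrite -dotp_eq0 e => w1.
rewrite -mulrA mulrCA (_ : _ * _ = 1).
  by rewrite scale1r opprB addrC subrK.
by field; move: w1; rewrite mulf_eq0 negb_or => /andP[].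
Qed.

Lemma reflection_fix u w : dotp u w = 0 -> u *m reflection w = u.
Proof. by move=> uw; rewrite mulmx_reflection uw mulr0 scale0r subr0. Qed.

Lemma orthogonal_dotp O u v : O^T *m O = 1%:M ->
  dotp (u *m O) (v *m O) = dotp u v.
Proof.
move=> OO; have {}OO := mulmx1C OO.
by rewrite /dotp trmx_mul -!mulmxA (mulmxA O) OO mul1mx.
Qed.

(** Orthonormal pairs of vectors. *)
Definition orthonormal2 p q := [/\ dotp p p = 1, dotp q q = 1 & dotp p q = 0].

(** The orthogonal group acts transitively on orthonormal pairs. *)
Lemma orthogonal_exists p q p' q' :
  orthonormal2 p q -> orthonormal2 p' q' ->
  exists O, [/\ O \in unitmx, O^T *m O = 1%:M, p *m O = p' & q *m O = q'].
Proof.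
move=> [pp qq pq] [pp' qq' pq'].
set O1 := reflection (p - p').
have pO1 : p *m O1 = p' by rewrite reflection_swap// pp.
have OO1 : O1^T *m O1 = 1%:M by exact: reflection_orthogonal.
set O2 := reflection (q *m O1 - q').
have qO2 : q *m O1 *m O2 = q' by rewrite reflection_swap// orthogonal_dotp// qq.
exists (O1 *m O2); rewrite unitmx_mul !reflection_unit !mulmxA pO1 qO2; split=> //.
  by rewrite trmx_mul -(mulmxA O2^T) OO1 mulmx1 reflection_orthogonal.
apply: reflection_fix; rewrite !dotp_bilin pq' -{1}pO1 orthogonal_dotp// pq; ring.
Qed.

(** The skew map [z |-> <z, p> q - <z, q> p]. *)
Definition wedge p q : 'M[R]_n := p^T *m q - q^T *m p.

Lemma mulmx_wedge u p q : u *m wedge p q = dotp u p *: q - dotp u q *: p.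
Proof. by rewrite mulmxBr !mulmx_outer. Qed.

Lemma wedge_mulmx p q u : wedge p q *m u^T = dotp q u *: p^T - dotp p u *: q^T.
Proof. by rewrite mulmxBl !outer_mulmx. Qed.

Lemma wedge_orthogonal O p q : O^T *m O = 1%:M ->
  O *m wedge (p *m O) (q *m O) = wedge p q *m O.
Proof.
move=> OO; have {}OO := mulmx1C OO.
by rewrite mulmxBr mulmxBl !trmx_mul !mulmxA OO !mul1mx.
Qed.

Lemma wedgeZl c p q : wedge (c *: p) q = c *: wedge p q.
Proof. by rewrite /wedge [(c *: p)^T]linearZ /= -scalemxAl -scalemxAr scalerBr. Qed.

Lemma wedgeZr c p q : wedge p (c *: q) = c *: wedge p q.
Proof. by rewrite /wedge [(c *: q)^T]linearZ /= -scalemxAl -scalemxAr scalerBr. Qed.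

Lemma wedgeNr p q : wedge p (- q) = - wedge p q.
Proof. by rewrite -scaleN1r wedgeZr scaleN1r. Qed.

Lemma wedgeDr p q r : wedge p (q + r) = wedge p q + wedge p r.
Proof. by rewrite /wedge [(q + r)^T]linearD /= mulmxDl mulmxDr opprD addrACA. Qed.

Lemma wedgeC p q : wedge p q = - wedge q p.
Proof. by rewrite /wedge opprB. Qed.

Lemma wedge0l p : wedge 0 p = 0.
Proof. by rewrite -(scale0r 0) wedgeZl scale0r. Qed.

Lemma wedge0r p : wedge p 0 = 0.
Proof. by rewrite -(scale0r 0) wedgeZr scale0r. Qed.

Lemma wedgexx p : wedge p p = 0.
Proof. exact: subrr. Qed.

(** [z |-> |a|^2 z - <z, a> a], a multiple of the orthogonal projection onto the
    complement of [a]. *)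
Definition perp a : 'M[R]_n := (dotp a a)%:M - a^T *m a.

Lemma mulmx_perp u a : u *m perp a = dotp a a *: u - dotp u a *: a.
Proof. by rewrite mulmxBr mulmx_outer mul_mx_scalar. Qed.

Lemma perp_orthogonal O a : O^T *m O = 1%:M ->
  O *m perp (a *m O) = perp a *m O.
Proof.
move=> OO; have OO' := mulmx1C OO.
rewrite mulmxBr mulmxBl orthogonal_dotp// !trmx_mul !mulmxA OO' !mul1mx.
by rewrite mul_scalar_mx mul_mx_scalar.
Qed.

Lemma perp0 : perp 0 = 0.
Proof. by rewrite /perp dotp0l mulmx0 raddf0 subrr. Qed.

Lemma perpZ c a : perp (c *: a) = c ^+ 2 *: perp a.
Proof.
rewrite /perp !dotp_bilin [(c *: a)^T]linearZ /= -scalemxAl -scalemxAr scalerA.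
by rewrite scalerBr scale_scalar_mx mulrA -expr2.
Qed.

(** Gram determinant of a pair of vectors. *)
Definition gram_det a b : R := dotp a a * dotp b b - dotp a b ^+ 2.

(** Gram-Schmidt: [wedge] only sees the plane spanned by its arguments, up to a
    nonzero factor. *)
Lemma wedge_orthonormal a b : gram_det a b != 0 ->
  exists c p q, [/\ c != 0, orthonormal2 p q & wedge a b = c *: wedge p q].
Proof.
move=> D0; set r := dotp a a *: b - dotp a b *: a.
have rr : dotp r r = dotp a a * gram_det a b.
  by rewrite /r /gram_det !dotp_bilin (dotpC b a); ring.
have a0 : a != 0.
  by apply: contra D0 => /eqP->; rewrite /gram_det !dotp0l expr0n mul0r subrr.
have aa0 : dotp a a != 0 by rewrite dotp_eq0.
have rr0 : dotp r r != 0 by rewrite rr mulf_neq0.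
set x := Num.sqrt (dotp a a); set y := Num.sqrt (dotp r r).
have xx : x ^+ 2 = dotp a a by rewrite sqr_sqrtr ?dotp_ge0.
have yy : y ^+ 2 = dotp r r by rewrite sqr_sqrtr ?dotp_ge0.
have x0 : x != 0 by move: aa0; rewrite -xx expf_eq0.
have y0 : y != 0 by move: rr0; rewrite -yy expf_eq0.
exists (x * y / dotp a a), (x^-1 *: a), (y^-1 *: r); split.
- by rewrite !mulf_neq0 ?invr_eq0.
- split; rewrite dotpZl dotpZr; first by rewrite -xx; field.
    by rewrite -yy; field.
  by rewrite /r !dotp_bilin; ring.
- rewrite wedgeZl wedgeZr /r wedgeDr wedgeZr wedgeNr wedgeZr wedgexx.
  rewrite scaler0 oppr0 addr0 !scalerA.
  set k := (X in X *: _).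
  by have -> : k = 1; rewrite ?scale1r// /k; field; rewrite x0 y0 aa0.
Qed.

End DotProduct.

(** * Similar matrices *)

Section Similarity.
Context {R : fieldType} {n : nat}.
Implicit Types A B C : 'M[R]_n.

Lemma similar_sym A B : similar_in unitmx A B -> similar_in unitmx B A.
Proof.
move=> [P uP /(similarP uP) e]; have uV : invmx P \in unitmx by rewrite unitmx_inv.
exists (invmx P) => //; apply/(similarP uV).
by rewrite -[A](mulKmx uP) e !mulmxA mulmxK.
Qed.

Lemma similar_trans A B C :
  similar_in unitmx A B -> similar_in unitmx B C -> similar_in unitmx A C.
Proof.
move=> [P uP /(similarP uP) e] [Q uQ /(similarP uQ) e'].
have uQP : Q *m P \in unitmx by rewrite unitmx_mul uQ.
by exists (Q *m P) => //; apply/(similarP uQP); rewrite -mulmxA e !mulmxA e'.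
Qed.

Lemma similar0 A : similar_in unitmx 0 A -> A = 0.
Proof.
move=> [P uP /(similarP uP)]; rewrite mulmx0 => /(congr1 (mulmxr (invmx P))) /=.
by rewrite mul0mx mulmxK.
Qed.

Lemma lin1_mxE (f : 'rV[R]_n -> 'rV[R]_n) A : (forall x, f x = x *m A) -> lin1_mx f = A.
Proof. by move=> fA; apply/matrixP => i j; rewrite mxE fA -rowE mxE. Qed.

End Similarity.

(** * Three-step nilpotent operators *)

Section Nilpotent.
Context {R : rcfType} {n : nat}.
Implicit Types (A B C X Y P : 'M[R]_n).

(** The endomorphism of the sum of three copies of [R^n] that maps the first
    summand to the other two by [A] and [B], and the second to the third by
    [C]. *)
Definition nil3 A B C : 'M[R]_(n + (n + n)) :=
  block_mx 0 (row_mx A B) 0 (block_mx 0 C 0 0).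

Lemma mulmx_nil3 (a b c : 'rV[R]_n) A B C :
  row_mx a (row_mx b c) *m nil3 A B C = row_mx 0 (row_mx (a *m A) (a *m B + b *m C)).
Proof.
rewrite /nil3 mul_row_block !mulmx0 addr0 mul_mx_row mul_row_block !mulmx0.
by rewrite !addr0 add_row_mx addr0.
Qed.

Lemma nil3_0 : nil3 0 0 0 = 0.
Proof. by rewrite /nil3 row_mx0 !block_mx0. Qed.

Lemma nil3_eq0 A B C : nil3 A B C = 0 -> A = 0 /\ B = 0.
Proof.
move=> /eqP; rewrite block_mx_eq0 row_mx_eq0.
by case/and4P => _ /andP[/eqP-> /eqP->].
Qed.

(** Similarity by a block upper triangular change of basis, whose first row of
    blocks is [P1], [P2], [0] and whose second is [0], [P4], [P5]. *)
Lemma nil3_similar A B C A' B' C' P1 P2 P4 P5 P6 :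
  P1 \in unitmx -> P4 \in unitmx -> P6 \in unitmx ->
  P1 *m A = A' *m P4 -> P4 *m C = C' *m P6 ->
  P1 *m B + P2 *m C = A' *m P5 + B' *m P6 ->
  similar_in unitmx (nil3 A B C) (nil3 A' B' C').
Proof.
move=> u1 u4 u6 eA eC eB.
set P := block_mx P1 (row_mx P2 0) 0 (block_mx P4 P5 0 P6).
have uP : P \in unitmx.
  by move: u1 u4 u6; rewrite !unitmxE !det_ublock !unitrM => -> -> ->.
exists P => //; apply/(similarP uP).
rewrite /P /nil3 !mulmx_block !(mul_row_col, mul_mx_row, mul_row_block, mulmx_block).
rewrite !(mulmx0, mul0mx, addr0, add0r, add_row_mx, row_mx0).
by rewrite eA eC eB.
Qed.

(** The unipotent change of basis with off-diagonal blocks [- Y], [X] removes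
    the corner block. *)
Lemma nil3_reduce A B C X Y :
  B = Y *m C + A *m X -> similar_in unitmx (nil3 A B C) (nil3 A 0 C).
Proof.
move=> ->; apply: (@nil3_similar _ _ _ _ _ _ 1%:M (- Y) 1%:M X 1%:M);
  rewrite ?unitmx1// ?mulmx1 ?mul1mx//.
by rewrite addr0 mulNmx addrAC subrr add0r.
Qed.

Lemma nil3_reduced_similar A C A' C' P1 P4 P6 :
  P1 \in unitmx -> P4 \in unitmx -> P6 \in unitmx ->
  P1 *m A = A' *m P4 -> P4 *m C = C' *m P6 ->
  similar_in unitmx (nil3 A 0 C) (nil3 A' 0 C').
Proof.
move=> u1 u4 u6 eA eC.
by apply: (@nil3_similar _ _ _ _ _ _ P1 0 P4 0 P6); rewrite ?mulmx0 ?mul0mx.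
Qed.

End Nilpotent.

Section NormalForms.
Context {R : rcfType} {n : nat}.
Implicit Types (a b p q w : 'rV[R]_n) (B : 'M[R]_n).

(** The component of [B] along [a] is determined by [a *m B], hence of the form
    [Y *m perp a], and [perp a] divides the rest. *)
Lemma nil3_perp_reduce a b B : a != 0 -> a *m B = - (b *m perp a) ->
  similar_in unitmx (nil3 (- perp a) B (perp a)) (nil3 (- perp a) 0 (perp a)).
Proof.
rewrite -dotp_eq0 => a0 aB.
apply: (@nil3_reduce _ _ _ _ _ (- ((dotp a a)^-1 *: B)) (- ((dotp a a)^-1 *: (a^T *m b)))).
rewrite mulNmx -scalemxAl -mulmxA mulNmx mulmxN opprK -scalemxAr.
rewrite -[b *m _]opprK -aB mulmxN scalerN opprK mulmxA -scalerDr -mulmxDl.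
rewrite [_ + perp a]addrC subrK.
by rewrite mul_scalar_mx scalerA mulVf// scale1r.
Qed.

(** A reflection maps the line of [a'] to that of [a]; powers of the ratio of
    their lengths, placed in the second and third blocks, absorb the scalar. *)
Lemma nil3_perp_similar a a' : a != 0 -> a' != 0 ->
  similar_in unitmx (nil3 (- perp a) 0 (perp a)) (nil3 (- perp a') 0 (perp a')).
Proof.
move=> a0 a'0; set k := Num.sqrt (dotp a a / dotp a' a').
have aa : dotp a a != 0 by rewrite dotp_eq0.
have aa' : dotp a' a' != 0 by rewrite dotp_eq0.
have kk : k ^+ 2 = dotp a a / dotp a' a' by rewrite sqr_sqrtr// divr_ge0 ?dotp_ge0.
have k0 : k ^+ 2 != 0 by rewrite kk mulf_neq0 ?invr_eq0.
set O := reflection (k *: a' - a).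
have uO : O \in unitmx by exact: reflection_unit.
have eO : (k *: a') *m O = a.
  by apply: reflection_swap; rewrite !dotp_bilin mulrA -expr2 kk divfK.
have e : O *m perp a = k ^+ 2 *: (perp a' *m O).
  by rewrite -{1}eO perp_orthogonal ?reflection_orthogonal// perpZ -scalemxAl.
have uZ c : c != 0 -> c *: O \in unitmx by move=> c0; rewrite unitmxZ// unitfE.
apply: (@nil3_reduced_similar _ _ _ _ _ _ O (k ^+ 2 *: O) (k ^+ 2 *: (k ^+ 2 *: O))).
- exact: uO.
- exact: uZ.
- by rewrite scalerA uZ// mulf_neq0.
- by rewrite mulmxN e mulNmx -scalemxAr.
- by rewrite -scalemxAl e -!scalemxAr.
Qed.

(** On the plane of [a], [b], the map [wedge a b] is invertible, which solves
    for the two multipliers. *)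
Lemma nil3_wedge_reduce a b w v : gram_det a b != 0 ->
  similar_in unitmx (nil3 (wedge a b) (wedge w a + wedge b v) (- wedge a b))
    (nil3 (wedge a b) 0 (- wedge a b)).
Proof.
move=> D0; set D := gram_det a b.
(* the basis of the plane dual to [a], [b] *)
pose al := D^-1 *: (dotp b b *: a - dotp a b *: b).
pose be := D^-1 *: (dotp a a *: b - dotp a b *: a).
have ala : dotp al a = 1.
  by rewrite /al !dotp_bilin (dotpC b a) -expr2 mulrC (mulrC (dotp b b)) mulfV.
have bea : dotp be a = 0 by rewrite /be !dotp_bilin (dotpC b a); ring.
have alb : dotp al b = 0 by rewrite /al !dotp_bilin; ring.
have beb : dotp be b = 1 by rewrite /be !dotp_bilin -expr2 mulrC mulfV.
have alK : al *m wedge a b = b by rewrite mulmx_wedge ala alb scale1r scale0r subr0.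
have beK : be *m wedge a b = - a by rewrite mulmx_wedge bea beb scale1r scale0r sub0r.
have Kal : wedge a b *m al^T = - b^T.
  by rewrite wedge_mulmx !(dotpC _ al) ala alb scale1r scale0r sub0r.
have Kbe : wedge a b *m be^T = a^T.
  by rewrite wedge_mulmx !(dotpC _ be) bea beb scale1r scale0r subr0.
apply: (@nil3_reduce _ _ _ _ _ (- (be^T *m w + al^T *m v)) (w^T *m be + v^T *m al)).
have -> : (w^T *m be + v^T *m al) *m - wedge a b = w^T *m a - v^T *m b.
  by rewrite mulmxN mulmxDl -!mulmxA alK beK mulmxN opprD opprK.
have -> : wedge a b *m - (be^T *m w + al^T *m v) = b^T *m v - a^T *m w.
  by rewrite mulmxN mulmxDr !mulmxA Kal Kbe mulNmx opprD opprK addrC.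
by rewrite /wedge addrACA [in RHS]addrACA; congr (_ + _); rewrite addrC.
Qed.

(** Both [wedge a b] and [wedge a' b'] are multiples of the wedge of an
    orthonormal pair, and an orthogonal map relates these pairs. *)
Lemma nil3_wedge_similar a b a' b' : gram_det a b != 0 -> gram_det a' b' != 0 ->
  similar_in unitmx (nil3 (wedge a b) 0 (- wedge a b))
    (nil3 (wedge a' b') 0 (- wedge a' b')).
Proof.
move=> /wedge_orthonormal [c [p [q [c0 pq ->]]]].
move=> /wedge_orthonormal [c' [p' [q' [c'0 pq' ->]]]].
have [T [uT TT <- <-]] := orthogonal_exists pq' pq.
have e : T *m (c *: wedge (p' *m T) (q' *m T)) = c' *: wedge p' q' *m (c / c' *: T).
  rewrite -scalemxAr wedge_orthogonal// -scalemxAl -scalemxAr scalerA.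
  by congr (_ *: _); field.
have uZ k : k != 0 -> k *: T \in unitmx by move=> k0; rewrite unitmxZ// unitfE.
have k0 : c / c' != 0 by rewrite mulf_neq0 ?invr_eq0.
apply: (@nil3_reduced_similar _ _ _ _ _ _ T (c / c' *: T) (c / c' *: (c / c' *: T))).
- exact: uT.
- exact: uZ.
- by rewrite scalerA uZ// mulf_neq0.
- exact: e.
- by rewrite mulmxN mulNmx -scalemxAl e -!scalemxAr.
Qed.
End NormalForms.

(** * Derivatives along coordinate directions *)

Section Jacobian.
Context {R : realType} {n : nat}.
Implicit Types (P : 'rV[R]_n).

(** [J] is the matrix of first-order partial derivatives at [P] of the
    row-vector valued map [G]: the derivative in direction [x] is [x *m J]. *)
Definition is_jacobian {m} (P : 'rV[R]_n) (G : 'rV[R]_n -> 'rV[R]_m)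
    (J : 'M[R]_(n, m)) : Prop :=
  forall i j, is_derive P (delta_mx 0 i) (fun Q => G Q 0 j) (J i j).

Lemma is_jacobian_id P : is_jacobian P id 1%:M.
Proof.
move=> i j; apply: DeriveDef.
  exact: diff_derivable (differentiable_coord P 0 j).
have /matrixP/(_ 0 j) := derive_mx (@derivable_id _ _ P (delta_mx 0 i)).
by rewrite derive_id !mxE eqxx /= eq_sym => ->.
Qed.

Lemma is_jacobian_mulmx m p P (G : 'rV[R]_n -> 'rV[R]_m) J (M : 'M[R]_(m, p)) :
  is_jacobian P G J -> is_jacobian P (fun Q => G Q *m M) (J *m M).
Proof.
move=> dG i j.
have -> : (fun Q => (G Q *m M) 0 j) = \sum_k ((fun Q => G Q 0 k) \* cst (M k j)).
  by apply/funext => Q; rewrite fct_sumE mxE.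
have dGk k : is_derive P (delta_mx 0 i) (fun Q => G Q 0 k) (J i k) by exact: dG.
rewrite mxE; apply: is_derive_eq.
apply: eq_bigr => k _.
by rewrite scaler0 add0r /GRing.scale /= mulrC.
Qed.

Lemma is_jacobianD m P (G H : 'rV[R]_n -> 'rV[R]_m) J K :
  is_jacobian P G J -> is_jacobian P H K ->
  is_jacobian P (fun Q => G Q + H Q) (J + K).
Proof.
move=> dG dH i j; rewrite mxE.
have -> : (fun Q => (G Q + H Q) 0 j) = (fun Q => G Q 0 j) \+ (fun Q => H Q 0 j).
  by apply/funext => Q; rewrite mxE.
exact: is_deriveD.
Qed.

Lemma is_jacobian_row_mx m p P (G : 'rV[R]_n -> 'rV[R]_m)
    (H : 'rV[R]_n -> 'rV[R]_p) J K :
  is_jacobian P G J -> is_jacobian P H K ->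
  is_jacobian P (fun Q => row_mx (G Q) (H Q)) (row_mx J K).
Proof.
move=> dG dH i j; rewrite !mxE; case: fintype.splitP => k jk.
  have -> : j = lshift _ k by exact/val_inj.
  by under eq_fun do rewrite row_mxEl; exact: dG.
have -> : j = rshift _ k by exact/val_inj.
by under eq_fun do rewrite row_mxEr; exact: dH.
Qed.

Lemma vf_der_jacobian m P (x : 'rV[R]_n) (G : 'rV[R]_n -> 'rV[R]_m) J k :
  is_jacobian P G J -> vf_der (fun=> x) (fun Q => G Q 0 k) P = (x *m J) 0 k.
Proof.
move=> dG; rewrite /vf_der mxE; apply: eq_bigr => i _; congr (_ * _).
exact: (@derive_val _ _ _ _ _ _ _ (dG i k)).
Qed.

Lemma vf_der_cst (X : 'rV[R]_n -> 'rV[R]_n) (c : R) P : vf_der X (fun=> c) P = 0.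
Proof. by rewrite /vf_der big1// => i _; rewrite /partial derive_cst mulr0. Qed.

Lemma vf_der_near_eq (M : set 'rV[R]_n) (X : 'rV[R]_n -> 'rV[R]_n) f h P :
  open M -> M P -> (forall Q, M Q -> f Q = h Q) -> vf_der X f P = vf_der X h P.
Proof.
move=> oM MP fh; apply: eq_bigr => i _; congr (_ * _).
exact: partial_near_eq oM MP fh.
Qed.

End Jacobian.

Section SeparableFunction.
Context {R : realType} {s : nat}.
Variables (O : set 'rV[R]_s) (F : 'rV[R]_s -> R) (f : 'I_s -> R -> R).
Hypothesis (openO : open O).
Hypothesis (FE : forall u, O u -> F u = \sum_(i < s) f i (u 0 i)).

(** Gradient and Hessian matrix of [F] in the standard coordinates. *)
Definition gradient u : 'rV[R]_s := \row_i partial i F u.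

Definition hessian u : 'M[R]_s := \matrix_(i, j) partial i (partial j F) u.

(** On [O] the partial derivative in direction [j] is a function of the [j]-th
    coordinate alone; no differentiability is needed, since the difference
    quotients themselves agree. *)
Lemma separable_mixed_partial i j u : O u -> i != j ->
  partial i (partial j F) u = 0.
Proof.
move=> Ou ij; pose psi r := lim ((fun h : R => h^-1 *: (f j (h + r) - f j r)) @ 0^').
have jF v : O v -> partial j F v = psi (v 0 j).
  move=> Ov; rewrite (partial_near_eq j openO Ov FE).
  rewrite /partial /derive /psi.
  rewrite [X in lim (X @ _)](_ : _ = fun h => h^-1 *: (f j (h + v 0 j) - f j (v 0 j)))//.
  apply/funext => h /=; congr (_ *: _).
  rewrite (bigD1 j)//= [X in _ - X](bigD1 j)//= !mxE !eqxx mulr1.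
  rewrite [X in _ + X - _](eq_bigr (fun k => f k (v 0 k))).
    by rewrite opprD addrACA subrr addr0.
  by move=> k /negPf kj; rewrite !mxE kj andbF mulr0 add0r.
rewrite (partial_near_eq i openO Ou jF) /partial /derive.
rewrite [X in lim (X @ _)](_ : _ = cst 0); first exact: lim_cst.
apply/funext => h /=.
by rewrite !mxE (negPf (_ : j != i)) ?andbF ?mulr0 ?add0r ?subrr ?scaler0// eq_sym.
Qed.

Lemma hessian_sym u : O u -> (hessian u)^T = hessian u.
Proof.
move=> Ou; apply/matrixP => i j; rewrite !mxE.
have [->//|ij] := eqVneq i j.
by rewrite !separable_mixed_partial// eq_sym.
Qed.

End SeparableFunction.

(** * The Levi-Civita connection and the curvature *)

Section Connection.
Context {R : realType} {s : nat}.
Variables (O : set 'rV[R]_s) (F : 'rV[R]_s -> R).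
Hypotheses (openO : open O) (smoothF : smooth_on O F).
Let M := manifold O.
Implicit Types (P Q x y z w : 'rV[R]_(s + (s + s))).

(** The [v] components, completing [ucoord] and [tcoord]. *)
Definition vcoord P : 'rV[R]_s := rsubmx (rsubmx P).

Lemma coordK P : row_mx (ucoord P) (row_mx (tcoord P) (vcoord P)) = P.
Proof. by rewrite /ucoord /tcoord /vcoord !hsubmxK. Qed.

Lemma ucoord_row (a b c : 'rV[R]_s) : ucoord (row_mx a (row_mx b c)) = a.
Proof. exact: row_mxKl. Qed.

Lemma tcoord_row (a b c : 'rV[R]_s) : tcoord (row_mx a (row_mx b c)) = b.
Proof. by rewrite /tcoord row_mxKr row_mxKl. Qed.

Lemma vcoord_row (a b c : 'rV[R]_s) : vcoord (row_mx a (row_mx b c)) = c.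
Proof. by rewrite /vcoord !row_mxKr. Qed.

Definition coord_row := (ucoord_row, tcoord_row, vcoord_row).

Lemma ucoordE P : ucoord P = P *m col_mx 1%:M 0.
Proof. by rewrite -{2}[P]coordK mul_row_col mulmx1 mulmx0 addr0. Qed.

Lemma tcoordE P : tcoord P = P *m col_mx 0 (col_mx 1%:M 0).
Proof. by rewrite -{2}[P]coordK !mul_row_col mulmx1 !mulmx0 addr0 add0r. Qed.

Lemma dotp_row m p (a c : 'rV[R]_m) (b d : 'rV[R]_p) :
  dotp (row_mx a b) (row_mx c d) = dotp a c + dotp b d.
Proof. by rewrite /dotp tr_row_mx mul_row_col mxE. Qed.

(** Functions of [u] alone do not vary in the [t] and [v] directions. *)
Lemma is_jacobian_ucoord P m (G : 'rV[R]_s -> 'rV[R]_m) J :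
  is_jacobian (ucoord P) G J ->
  is_jacobian P (fun Q => G (ucoord Q)) (col_mx J 0).
Proof.
move=> dG i j.
have e : is_derive (ucoord P) (ucoord (delta_mx 0 i)) (fun u => G u 0 j) ((col_mx J 0) i j).
  rewrite ucoord_delta mxE; case: fintype.split => k; first exact: dG.
  apply: DeriveDef; first exact: derivable0.
  by rewrite derive0 mxE.
apply: DeriveDef.
  have := @ex_derive _ _ _ _ _ _ _ e.
  by rewrite /derivable -ucoord_quotient.
rewrite -(@derive_val _ _ _ _ _ _ _ e) /derive.
by rewrite -[in RHS]ucoord_quotient.
Qed.

Lemma gradient_jacobian u : O u -> is_jacobian u (gradient F) (hessian F u).
Proof.
move=> Ou i j; rewrite mxE.
rewrite (_ : (fun v => _) = partial j F); last by apply/funext => v; rewrite mxE.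
by apply: DeriveDef => //; have [_ /(_ i)] := smoothF [:: j] Ou.
Qed.

(** The pair formed of the [u] and [t] components of the gradient of [guu],
    divided by [-2]; the connection is linear in it. *)
Definition potential P : 'rV[R]_(s + s) :=
  row_mx (gradient F (ucoord P) + tcoord P) (ucoord P).

(** The Jacobian matrix of [potential]. *)
Definition potential_jac P : 'M[R]_(s + (s + s), s + s) :=
  row_mx (col_mx (hessian F (ucoord P)) 0 + col_mx 0 (col_mx 1%:M 0)) (col_mx 1%:M 0).

Lemma ucoord_jacobian P : is_jacobian P ucoord (col_mx 1%:M 0).
Proof.
rewrite (_ : ucoord = fun Q => id Q *m col_mx 1%:M 0); last exact/funext/ucoordE.
by rewrite -[X in is_jacobian _ _ X]mul1mx; exact/is_jacobian_mulmx/is_jacobian_id.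
Qed.

Lemma tcoord_jacobian P : is_jacobian P tcoord (col_mx 0 (col_mx 1%:M 0)).
Proof.
rewrite (_ : tcoord = fun Q => id Q *m col_mx 0 (col_mx 1%:M 0)); last exact/funext/tcoordE.
by rewrite -[X in is_jacobian _ _ X]mul1mx; exact/is_jacobian_mulmx/is_jacobian_id.
Qed.

Lemma potential_jacobian P : M P -> is_jacobian P potential (potential_jac P).
Proof.
move=> MP.
have ju := ucoord_jacobian P; have jt := tcoord_jacobian P.
apply: is_jacobian_row_mx => //; apply: is_jacobianD => //.
exact/is_jacobian_ucoord/gradient_jacobian.
Qed.

Lemma mulmx_potential_jac P x : x *m potential_jac P =
  row_mx (ucoord x *m hessian F (ucoord P) + tcoord x) (ucoord x).
Proof.
rewrite mul_mx_row -ucoordE mulmxDr -tcoordE; congr (row_mx (_ + _) _).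
by rewrite -{1}[x]coordK mul_row_col mulmx0 addr0.
Qed.

(** The gradient of [guu] divided by [-2]. *)
Definition guu_grad P : 'rV[R]_(s + (s + s)) :=
  row_mx (gradient F (ucoord P) + tcoord P) (row_mx (ucoord P) 0).

Lemma is_derive_guu P i : M P ->
  is_derive P (delta_mx 0 i) (guu F) (- 2 * guu_grad P 0 i).
Proof.
move=> MP.
have dF : is_derive P (delta_mx 0 i) (fun Q => F (ucoord Q))
    ((col_mx (gradient F (ucoord P))^T 0 : 'cV_(s + (s + s))) i 0).
  have jF : is_jacobian (ucoord P) (fun v => (F v)%:M) (gradient F (ucoord P))^T.
    move=> k l; rewrite !ord1 !mxE.
    rewrite (_ : (fun v => _) = F); last by apply/funext => v; rewrite mxE eqxx.
    by apply: DeriveDef => //; have [_ /(_ k)] := smoothF [::] MP.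
  have := is_jacobian_ucoord jF i 0.
  by under eq_fun do rewrite mxE eqxx mulr1n.
have [/(_ i) du /(_ i) dt] : is_jacobian P ucoord (col_mx 1%:M 0) /\
    is_jacobian P tcoord (col_mx 0 (col_mx 1%:M 0)).
  by split; [exact: ucoord_jacobian|exact: tcoord_jacobian].
rewrite (_ : guu F = (- 2 *: (fun Q => F (ucoord Q))) -
  2 *: \sum_k ((fun Q => ucoord Q 0 k) \* (fun Q => tcoord Q 0 k))); last first.
  apply/funext => Q /=; rewrite /guu !fctE fct_sumE; congr (_ - _ * _).
apply: is_derive_eq.
have -> : guu_grad P 0 i = ((col_mx (gradient F (ucoord P))^T 0 +
    (col_mx 1%:M 0 *m (tcoord P)^T +
     col_mx 0 (col_mx 1%:M 0) *m (ucoord P)^T)) : 'cV_(s + (s + s))) i 0.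
  rewrite !mul_col_mx !mul0mx !mul1mx !add_col_mx !add0r !addr0 -linearD /=.
  by rewrite -[X in col_mx _ (col_mx _ X)]trmx0 -!tr_row_mx [RHS]mxE.
rewrite [in RHS]mxE [X in _ = _ * (_ + X)]mxE.
have -> : (col_mx 1%:M 0 *m (tcoord P)^T : 'cV_(s + (s + s))) i 0 =
    \sum_k tcoord P 0 k * (col_mx 1%:M 0 : 'M[R]_(s + (s + s), s)) i k.
  by rewrite mxE; apply: eq_bigr => k _; rewrite [X in _ * X]mxE mulrC.
have -> : (col_mx 0 (col_mx 1%:M 0) *m (ucoord P)^T : 'cV_(s + (s + s))) i 0 =
    \sum_k ucoord P 0 k * (col_mx 0 (col_mx 1%:M 0) : 'M[R]_(s + (s + s), s)) i k.
  by rewrite mxE; apply: eq_bigr => k _; rewrite [X in _ * X]mxE mulrC.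
rewrite big_split /= /GRing.scale /=; ring.
Qed.

(** The inverse of the metric. *)
Definition gF_inv P : 'M[R]_(s + (s + s)) :=
  block_mx 0 (row_mx 0 1%:M)
           (col_mx 0 1%:M) (block_mx (- 1%:M) 0 0 (- guu F P)%:M).

Lemma gF_mul_inv P : gF F P *m gF_inv P = 1%:M.
Proof.
rewrite /gF /gF_inv mulmx_block !mulmx0 !add0r mul_mx_row !mul_row_block mul_row_col.
rewrite !(mulmx0, mul0mx, mulmx1, mul1mx, addr0, add0r) add_row_mx addr0.
rewrite mul_block_col mulmx_block mul_col_row !(mulmx0, mul0mx, mulmx1, mul1mx, addr0, add0r).
rewrite add_block_mx !(addr0, add0r) mulNmx mulmxN opprK mulmx1.
rewrite raddfN addrN row_mx0.
by rewrite -!scalar_mx_block col_mx0 -scalar_mx_block.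
Qed.

Lemma gF_unit P : gF F P \in unitmx.
Proof. by have [] := mulmx1_unit (gF_mul_inv P). Qed.

Lemma invmx_gF P : invmx (gF F P) = gF_inv P.
Proof. by rewrite -[RHS](mulKmx (gF_unit P)) gF_mul_inv mulmx1. Qed.

(** The coefficient of [guu] in [gF], whose other entries are constant. *)
Definition uproj : 'M[R]_(s + (s + s)) := block_mx 1%:M 0 0 0.

Lemma mulmx_uproj x : x *m uproj = row_mx (ucoord x) 0.
Proof. by rewrite -{1}[x]coordK mul_row_block mulmx1 !mulmx0 !addr0. Qed.

Lemma partial_gF P i j l : M P ->
  partial i (fun Q => gF F Q j l) P = - 2 * guu_grad P 0 i * uproj j l.
Proof.
move=> MP.
have -> : (fun Q => gF F Q j l) = (uproj j l *: guu F + cst ((gF F P - guu F P *: uproj) j l)).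
  apply/funext => Q; transitivity (uproj j l * guu F Q +
    (gF F P - guu F P *: uproj) j l) => //; rewrite mulrC.
  have -> : gF F Q = guu F Q *: uproj + (gF F P - guu F P *: uproj).
    rewrite /gF /uproj !scale_block_mx !scaler0 !scale_scalar_mx !mulr1.
    by rewrite opp_block_mx !oppr0 !add_block_mx !addr0 addrN !add0r addr0.
  by rewrite [in LHS]mxE [X in X + _]mxE.
have dg := is_derive_guu i MP; rewrite /partial.
have dc := derivable_cst ((gF F P - guu F P *: uproj) j l) P
  (delta_mx 0 i : 'rV[R]_(s + (s + s))).
have dgu := @ex_derive _ _ _ _ _ _ _ dg.
rewrite deriveD ?deriveZ ?derive_cst ?addr0 ?derive_val//.
by rewrite /GRing.scale /= mulrC.
Qed.

(** [potential P *m gam y z] is the covariant derivative at [P] of the constant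
    field [z] in the direction [y]. *)
Definition gam y z : 'M[R]_(s + s, s + (s + s)) :=
  let a := ucoord y in let c := ucoord z in
  block_mx 0 (row_mx 0 ((dotp a c)%:M - a^T *m c - c^T *m a))
           0 (row_mx (- (dotp a c)%:M) (- ((tcoord y)^T *m c + (tcoord z)^T *m a))).

Lemma mulmx_gam (p q : 'rV[R]_s) y z : row_mx p q *m gam y z =
  row_mx 0 (row_mx (- (dotp (ucoord y) (ucoord z) *: q))
    (dotp (ucoord y) (ucoord z) *: p - dotp p (ucoord y) *: ucoord z
     - dotp p (ucoord z) *: ucoord y
     - dotp q (tcoord y) *: ucoord z - dotp q (tcoord z) *: ucoord y)).
Proof.
rewrite /gam mul_row_block !mulmx0 addr0 !mul_mx_row mulmx0 add_row_mx add0r.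
rewrite mulmxN mul_mx_scalar !mulmxBr mulmxN mulmxDr !mulmx_outer mul_mx_scalar.
by rewrite opprD !addrA.
Qed.

Lemma christoffel_contraction P y z : M P ->
  \row_k \sum_i \sum_j christoffel (gF F) k i j P * y 0 i * z 0 j =
  potential P *m gam y z.
Proof.
move=> MP; set d := guu_grad P.
transitivity ((dotp (ucoord y) (ucoord z) *: d - dotp d y *: (z *m uproj)
  - dotp d z *: (y *m uproj)) *m gF_inv P).
  apply/rowP => k; rewrite [LHS]mxE [RHS]mxE.
  (* both sides are sums over l of an entry of the inverse metric times a
     contraction over i and j *)
  transitivity (\sum_l \sum_i \sum_j
      (uproj i j * d 0 l - d 0 i * uproj j l - d 0 j * uproj i l) *
      gF_inv P l k * y 0 i * z 0 j).
    rewrite [RHS]exchange_big /=; apply: eq_bigr => i _.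
    rewrite [RHS]exchange_big /=; apply: eq_bigr => j _.
    rewrite /christoffel mulr_sumr !mulr_suml; apply: eq_bigr => l _.
    rewrite invmx_gF !partial_gF//.
    have -> : gF_inv P k l = gF_inv P l k.
      rewrite -{1}(trmxK (gF_inv P)) mxE -invmx_gF trmx_inv gF_sym //.
    by rewrite -/d; field.
  apply: eq_bigr => l _.
  have -> : \sum_i \sum_j (uproj i j * d 0 l - d 0 i * uproj j l - d 0 j * uproj i l) *
      gF_inv P l k * y 0 i * z 0 j =
    ((\sum_i \sum_j y 0 i * uproj i j * z 0 j) * d 0 l
     - (\sum_i d 0 i * y 0 i) * (\sum_j z 0 j * uproj j l)
     - (\sum_j d 0 j * z 0 j) * (\sum_i y 0 i * uproj i l)) * gF_inv P l k.
    rewrite !big_distrlr /= [in X in _ - _ - X]exchange_big /= !mulr_suml.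
    rewrite -!sumrB mulr_suml; apply: eq_bigr => i _.
    rewrite mulr_suml -!sumrB mulr_suml. apply: eq_bigr => j _; ring.
  rewrite !mxE -!dotpE; congr ((_ * _ - _ * _ - _ * _) * _).
  transitivity (dotp (y *m uproj) z).
    rewrite exchange_big dotpE; apply: eq_bigr => j _ /=.
    by rewrite mxE mulr_suml.
  by rewrite mulmx_uproj -{1}[z]coordK dotp_row dotp0l addr0.
rewrite !mulmx_uproj mulmx_gam /d /guu_grad /gF_inv.
have dd x : dotp (row_mx (gradient F (ucoord P) + tcoord P) (row_mx (ucoord P) 0)) x =
    dotp (gradient F (ucoord P) + tcoord P) (ucoord x) + dotp (ucoord P) (tcoord x).
  by rewrite -{1}[x]coordK !dotp_row dotp0l addr0.
rewrite !dd.
have E (a : 'rV[R]_s) : row_mx a (0 : 'rV_(s + s)) = row_mx a (row_mx 0 0) by rewrite row_mx0.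
rewrite !E !(scale_row_mx, opp_row_mx, add_row_mx, scaler0, oppr0, addr0).
rewrite mul_row_block mulmx0 add0r !(mul_mx_row, mul_row_col, mul_row_block).
rewrite !(mulmx0, mul0mx, mulmx1, addr0, add0r) mulmxN mulmx1 !add_row_mx !(add0r, addr0).
congr (row_mx 0 (row_mx _ _)).
apply/rowP => k; rewrite !mxE; ring.
Qed.

Lemma nabla_cst P y z : M P ->
  nabla (gF F) (fun=> y) (fun=> z) P = potential P *m gam y z.
Proof.
move=> MP; rewrite -christoffel_contraction//; apply/rowP => k; rewrite !mxE.
by rewrite vf_der_cst add0r.
Qed.

Lemma nabla_nabla_cst P x y z : M P ->
  nabla (gF F) (fun=> x) (nabla (gF F) (fun=> y) (fun=> z)) P =
  x *m potential_jac P *m gam y z + potential P *m gam x (potential P *m gam y z).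
Proof.
move=> MP; rewrite -(christoffel_contraction _ _ MP); apply/rowP => k.
rewrite [LHS]mxE [RHS]mxE; congr (_ + _).
  have e Q : M Q -> nabla (gF F) (fun=> y) (fun=> z) Q 0 k = (potential Q *m gam y z) 0 k.
    by move=> MQ; rewrite nabla_cst.
  rewrite (vf_der_near_eq _ (manifold_open openO) MP e) -mulmxA.
  exact/vf_der_jacobian/is_jacobian_mulmx/potential_jacobian.
by rewrite mxE nabla_cst.
Qed.

Lemma lie_bracket_cst x y : lie_bracket (fun=> x) (fun=> y) = fun=> 0.
Proof. by apply/funext => Q; apply/rowP => k; rewrite !mxE !vf_der_cst subrr. Qed.

(** With constant fields the bracket term drops out, and the curvature is the
    commutator of two covariant derivatives. *)
Lemma curvature_op_gam P x y z : M P -> curvature_op (gF F) P x y z =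
    x *m potential_jac P *m gam y z + potential P *m gam x (potential P *m gam y z)
  - (y *m potential_jac P *m gam x z + potential P *m gam y (potential P *m gam x z)).
Proof.
move=> MP; rewrite /curvature_op /curvature_vf !nabla_nabla_cst// lie_bracket_cst.
rewrite nabla_cst// -[RHS]subr0; congr (_ - _); apply/rowP => k.
rewrite -(christoffel_contraction _ _ MP) !mxE big1// => i _.
by rewrite big1// => j _; rewrite mxE mulr0 mul0r.
Qed.

Hypothesis hessianC : forall u, O u -> (hessian F u)^T = hessian F u.

(** The vector paired with the [u] components of the other argument in the
    curvature operator. The term [|u|^2 wedge b a] of the curvature is
    split evenly between the two wedge products, whence the factor [2^-1]. *)
Definition wedge_partner P x : 'rV[R]_s :=
  ucoord x *m hessian F (ucoord P) + tcoord x +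
  (2^-1 * dotp (ucoord P) (ucoord P)) *: ucoord x.

Lemma curvature_opE P x y z : M P ->
  let a := ucoord x in let b := ucoord y in
  curvature_op (gF F) P x y z =
  row_mx 0 (row_mx (ucoord z *m wedge a b)
    (ucoord z *m (wedge (wedge_partner P y) a + wedge b (wedge_partner P x))
     - tcoord z *m wedge a b)).
Proof.
move=> MP a b; rewrite curvature_op_gam// !mulmx_potential_jac /potential !mulmx_gam.
rewrite !coord_row !dotp0r !scale0r !scaler0 !subr0 !oppr0 !sub0r.
rewrite !(opp_row_mx, add_row_mx, oppr0, addr0).
congr (row_mx 0 (row_mx _ _)).
  by rewrite mulmx_wedge !(dotpC (ucoord z)) opprK addrC.
have Hab : dotp (ucoord x *m hessian F (ucoord P)) (ucoord y) =
    dotp (ucoord y *m hessian F (ucoord P)) (ucoord x).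
  by rewrite [RHS]dotpC /dotp trmx_mul hessianC// mulmxA.
rewrite mulmxDr !mulmx_wedge /wedge_partner -/a -/b.
rewrite !dotp_bilin -/a -/b in Hab *.
rewrite !(dotpC (ucoord z)) !(dotpC (tcoord z)) (dotpC (tcoord x) b) (dotpC (tcoord y) a) Hab.
by apply/rowP => k; rewrite !mxE; field.
Qed.

End Connection.

(** * The Weyl operators *)

Section Weyl.
Context {R : realType} {s : nat}.
Variables (O : set 'rV[R]_s) (F : 'rV[R]_s -> R).
Hypotheses (openO : open O) (smoothF : smooth_on O F).
Hypothesis hessianC : forall u, O u -> (hessian F u)^T = hessian F u.
Let M := manifold O.
Implicit Types (P Q x y z w : 'rV[R]_(s + (s + s))).
Variable P : 'rV[R]_(s + (s + s)).
Hypothesis MP : M P.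

Let curvE x y z := curvature_opE openO smoothF hessianC x y z MP.

Lemma ucoord_delta_r i : ucoord (delta_mx 0 (rshift s i) : 'rV[R]_(s + (s + s))) = 0.
Proof. by apply/rowP => k; rewrite !mxE eq_lrshift. Qed.

Lemma tcoord_delta_r i :
  tcoord (delta_mx 0 (rshift s (rshift s i)) : 'rV[R]_(s + (s + s))) = 0.
Proof. by apply/rowP => k; rewrite !mxE (inj_eq (@rshift_inj _ _)) eq_lrshift. Qed.

(** Every term of the contraction vanishes: the only nonzero entries of the
    inverse metric pair [u] with [v], [t] with [t], or [v] with [v] directions,
    and [R(x, y) z] is zero when [y] or [z] is a [v] direction and when neither
    [y] nor [z] has a [u] component. *)
Lemma ricci_eq0 x y : ricci (gF F) P x y = 0.
Proof.
rewrite /ricci big1// => i _; rewrite big1// => j _.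
rewrite invmx_gF /curvature curvE.
have v0 k : wedge_partner F P (delta_mx 0 (rshift s (rshift s k))) = 0.
  by rewrite /wedge_partner ucoord_delta_r tcoord_delta_r mul0mx scaler0 !addr0.
have g0 z : gform (gF F P) (row_mx 0 (row_mx 0 0)) z = 0.
  by rewrite !row_mx0 /gform !mul0mx mxE.
case: (split_ordP i) => {i} i ->; case: (split_ordP j) => {j} j ->.
- by rewrite block_mxEul mxE mul0r.
- case: (split_ordP j) => {j} j ->.
    by rewrite block_mxEur row_mxEl mxE mul0r.
  by rewrite ucoord_delta_r tcoord_delta_r !mul0mx subrr g0 mulr0.
- case: (split_ordP i) => {i} i ->.
    by rewrite block_mxEdl col_mxEu mxE mul0r.
  by rewrite ucoord_delta_r v0 wedge0r !wedge0l addr0 !mulmx0 subrr g0 mulr0.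
- by rewrite !ucoord_delta_r wedge0r !mul0mx mulmx0 subrr g0 mulr0.
Qed.

(** The Weyl tensor of a Ricci-flat metric is its curvature tensor. *)
Lemma weyl_opE x y z : weyl_op (gF F) P x y z = curvature_op (gF F) P x y z.
Proof.
have tau0 : scalar_curvature (gF F) P = 0.
  by rewrite /scalar_curvature big1// => i _; rewrite big1// => j _; rewrite ricci_eq0 mulr0.
rewrite /weyl_op -[RHS](mulmxK (gF_unit F P)); congr (_ *m _).
apply/rowP => l; rewrite mxE /weyl tau0 !ricci_eq0.
rewrite !(mul0r, mulr0, addr0, subr0).
by rewrite /curvature /gform trmx_delta -colE mxE.
Qed.

Lemma weyl_mxE x y :
  let a := ucoord x in let b := ucoord y in
  weyl_mx (gF F) P x y = nil3 (wedge a b)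
    (wedge (wedge_partner F P y) a + wedge b (wedge_partner F P x)) (- wedge a b).
Proof.
move=> a b; apply: lin1_mxE => z; rewrite weyl_opE curvE.
by rewrite -[z in RHS]coordK mulmx_nil3 mulmxN.
Qed.

(** Only the value of the corner block [B] at [a] matters for the normal form. *)
Lemma jacobi_weylE x : let a := ucoord x in
  exists B, [/\ jacobi_weyl (gF F) P x = nil3 (- perp a) B (perp a),
    a *m B = - (tcoord x *m perp a) & a = 0 -> B = 0].
Proof.
move=> a; pose H := hessian F (ucoord P); pose h := dotp (ucoord P) (ucoord P).
pose B : 'M[R]_s := dotp a a *: (H + h%:M) - H *m (a^T *m a) - (tcoord x)^T *m a
  - a^T *m (a *m H + tcoord x + h *: a) + (dotp (a *m H) a + 2 * dotp (tcoord x) a)%:M.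
have yB (y : 'rV[R]_s) : y *m B = dotp a a *: (y *m H + h *: y) - dotp (y *m H) a *: a
    - dotp y (tcoord x) *: a - dotp y a *: (a *m H + tcoord x + h *: a)
    + (dotp (a *m H) a + 2 * dotp (tcoord x) a) *: y.
  rewrite /B; move: (_ + _ + h *: a) => c.
  rewrite !mulmxDr !mulmxN (mulmxA y H) !mulmx_outer !mul_mx_scalar.
  by rewrite -scalemxAr mulmxDr mul_mx_scalar.
exists B; split; last 2 first.
- rewrite yB mulmx_perp (dotpC a (tcoord x)).
  by apply/rowP => k; rewrite !mxE; ring.
- move=> a0; apply/row_matrixP => k; rewrite !rowE yB a0 mulmx0.
  by rewrite !(mul0mx, dotp_bilin, scaler0, scale0r, mulr0, subr0, addr0).
apply: lin1_mxE => y; rewrite weyl_opE curvE -[y in RHS]coordK mulmx_nil3 -/a.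
congr (row_mx 0 (row_mx _ _)).
  by rewrite mulmx_wedge mulmxN mulmx_perp opprB (dotpC (ucoord y)).
rewrite yB mulmxDr !mulmx_wedge mulmx_perp /wedge_partner -/a -/H -/h.
rewrite !(dotp_bilin, mulmxDl, mulmxBl).
rewrite (dotpC a (a *m H)) (dotpC a (tcoord x)) !(dotpC _ (ucoord y)).
rewrite (dotpC a (ucoord y *m H)) (dotpC a (tcoord y)).
by apply/rowP => k; rewrite !mxE; field.
Qed.

End Weyl.

(** * Spacelike and timelike vectors and mixed planes *)

Section TangentVectors.
Context {R : realType} {s : nat}.
Variables (F : 'rV[R]_s -> R) (P : 'rV[R]_(s + (s + s))).
Implicit Types (x y : 'rV[R]_(s + (s + s))) (i j : 'I_s).
Let e i : 'rV[R]_s := delta_mx 0 i.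
Let g := gF F P.

Lemma gform_gF x y : gform g x y =
  guu F P * dotp (ucoord x) (ucoord y) + dotp (ucoord x) (vcoord y)
  + dotp (vcoord x) (ucoord y) - dotp (tcoord x) (tcoord y).
Proof.
rewrite /gform -{1}[x]coordK -{1}[y]coordK /g /gF mul_row_block mul_mx_row mul_row_col.
rewrite mul_row_block !(mulmx0, mulmx1) !(addr0, add0r) mul_mx_scalar mulmxN mulmx1.
rewrite add_row_mx add0r addr0 !tr_row_mx !mul_row_col mulmxDl -scalemxAl mulNmx.
rewrite /dotp !mxE; ring.
Qed.

Lemma gform_ucoord0 x : ucoord x = 0 -> gform g x x <= 0.
Proof. by move=> x0; rewrite gform_gF x0 !dotp_bilin mulr0 !add0r oppr_le0 dotp_ge0. Qed.

Lemma spacelike_ucoord_neq0 x : 0 < gform g x x -> ucoord x != 0.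
Proof. by move=> xx; apply/negP => /eqP /gform_ucoord0; rewrite leNgt xx. Qed.

(** A spacelike plane projects injectively to the [u] directions: the kernel
    of the projection contains no spacelike vector. *)
Lemma spacelike_onb_gram_det x y : spacelike_onb (gF F) P x y ->
  gram_det (ucoord x) (ucoord y) != 0.
Proof.
move=> [xx yy xy]; apply/eqP => D0.
have x0 : ucoord x != 0 by apply: spacelike_ucoord_neq0; rewrite /g xx.
pose l := dotp (ucoord x) (ucoord x); pose m := dotp (ucoord x) (ucoord y).
pose z := l *: y - m *: x.
have uz : ucoord z = l *: ucoord y - m *: ucoord x.
  by rewrite /z /ucoord linearB !linearZ.
have z0 : ucoord z = 0.
  apply/eqP; rewrite -dotp_eq0 uz !dotp_bilin (dotpC (ucoord y)) -/l -/m; apply/eqP.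
  transitivity (l * gram_det (ucoord x) (ucoord y)); last by rewrite D0 mulr0.
  by rewrite /gram_det -/l -/m; ring.
have := gform_ucoord0 z0.
have -> : gform g z z = l ^+ 2 + m ^+ 2.
  rewrite /z !(gformDl, gformDr) -!scaleNr !gformZl !gformZr xx yy xy.
  by rewrite (gformC _ _ (gF_sym F P)) xy; ring.
by rewrite leNgt ltr_wpDr ?sqr_ge0// exprn_gt0// lt0r dotp_ge0 dotp_eq0 x0.
Qed.

(** The coordinate vector [d/dt_i]. *)
Definition tvec i : 'rV[R]_(s + (s + s)) := row_mx 0 (row_mx (e i) 0).

(** The vector of square norm [c] in the plane of [d/du_i] and [d/dv_i] whose
    [d/du_i] component is 1. *)
Definition uvec i c : 'rV[R]_(s + (s + s)) :=
  row_mx (e i) (row_mx 0 (((c - guu F P) / 2) *: e i)).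

Lemma dotp_e i j : dotp (e i) (e j) = (i == j)%:R.
Proof. by rewrite /e dotp_delta_r mxE eqxx /= eq_sym. Qed.

Lemma e_neq0 i : e i != 0.
Proof. by rewrite -dotp_eq0 dotp_e eqxx oner_neq0. Qed.

Lemma gform_tvec i j : gform g (tvec i) (tvec j) = - (i == j)%:R.
Proof. by rewrite gform_gF !coord_row !dotp_bilin dotp_e mulr0 !add0r. Qed.

Lemma gform_uvec_tvec i j c : gform g (uvec i c) (tvec j) = 0.
Proof. by rewrite gform_gF !coord_row !(dotp_bilin, mulr0, add0r, oppr0). Qed.

Lemma gform_uvec i j c : gform g (uvec i c) (uvec j c) = c * (i == j)%:R.
Proof. by rewrite gform_gF !coord_row !dotp_bilin dotp_e; field. Qed.

Lemma gram2E x y : gform g x y = 0 ->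
  gram2 (gF F) P x y = block_mx (gform g x x)%:M 0 0 (gform g y y)%:M.
Proof.
move=> xy; have yx : gform g y x = 0 by rewrite (gformC _ _ (gF_sym F P)).
have gE a b : a *m gF F P *m b^T = (gform g a b)%:M by rewrite [LHS]mx11_scalar.
rewrite /gram2 tr_col_mx mul_col_mx mul_col_row !gE xy yx.
by rewrite !raddf0.
Qed.

(** An orthonormal basis of a mixed plane needs no normalization. *)
Lemma mixed_basis_orthonormal x y :
  gform g x x = 1 -> gform g y y = -1 -> gform g x y = 0 ->
  mixed_basis (gF F) P x y /\ skew_weyl_mixed (gF F) P x y = weyl_mx (gF F) P x y.
Proof.
move=> xx yy xy; have G := gram2E xy; rewrite xx yy in G.
have dG : \det (gram2 (gF F) P x y) = -1.
  by rewrite G det_ublock !det_scalar1 mul1r.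
split; last by rewrite /skew_weyl_mixed dG normrN1 sqrtr1 invr1 scale1r.
split.
  have uG : gram2 (gF F) P x y \in unitmx by rewrite unitmxE dG unitrN1.
  rewrite /row_free eqn_leq rank_leq_row -[X in (X <= _)%N](mxrank_unit uG).
  by rewrite /gram2 -mulmxA mxrankM_maxl.
have GE (a b : 'rV[R]_1) :
    gform (gram2 (gF F) P x y) (row_mx a b) (row_mx a b) = dotp a a - dotp b b.
  rewrite /gform G mul_row_block !mulmx0 addr0 add0r tr_row_mx mul_row_col mulmx1.
  by rewrite mul_mx_scalar scaleN1r mulNmx mxE [X in _ + X]mxE.
apply: (@has_signatureP _ _ _ _ _ _ _ (row_mx 0 1%:M : 'M[R]_(1, 1 + 1))
  (row_mx 1%:M 0 : 'M[R]_(1, 1 + 1))) => //.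
- by rewrite G tr_block_mx !tr_scalar_mx !trmx0.
- move=> _ /submxP[D ->]; rewrite mul_mx_row mulmx0 mulmx1 GE dotp0l sub0r => D0.
  rewrite oppr_lt0 lt0r dotp_ge0 dotp_eq0 andbT.
  by apply: contra D0 => /eqP->; rewrite row_mx0.
- move=> _ /submxP[D ->]; rewrite mul_mx_row mulmx0 mulmx1 GE dotp0l subr0 => D0.
  rewrite lt0r dotp_ge0 dotp_eq0 andbT.
  by apply: contra D0 => /eqP->; rewrite row_mx0.
- by rewrite rank_row_0mx mxrank1.
- by rewrite rank_row_mx0 mxrank1.
Qed.

End TangentVectors.

Theorem theorem3p7 (R : realType) (s : nat) (hs : (2 <= s)%N)
    (O : set 'rV[R]_s) (hO : open O) (hO0 : O !=set0)
    (F : 'rV[R]_s -> R) (f : 'I_s -> R -> R)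
    (hF : forall u, O u -> F u = \sum_(i < s) f i (u 0 i))
    (hFsmooth : smooth_on O F) :
  [/\ conformally_spacelike_jordan_osserman (manifold O) (gF F) /\
        ~ conformally_timelike_jordan_osserman (manifold O) (gF F),
      conformally_spacelike_jordan_ivanov_petrova (manifold O) (gF F)
    & ~ conformally_timelike_jordan_ivanov_petrova (manifold O) (gF F) /\
        ~ conformally_mixed_jordan_ivanov_petrova (manifold O) (gF F)].
Proof.
have hH u : O u -> (hessian F u)^T = hessian F u
  := fun Ou => hessian_sym hO hF Ou.
have JE P (MP : manifold O P) := jacobi_weylE hO hFsmooth hH MP.
have WE P (MP : manifold O P) := weyl_mxE hO hFsmooth hH MP.
have [u0 Ou0] := hO0.
pose P0 : 'rV[R]_(s + (s + s)) := row_mx u0 0.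
have MP0 : manifold O P0 by rewrite /manifold /= /P0 /ucoord row_mxKl.
(* [i0] and [i1] are the indices 0 and 1; they are distinct as [2 <= s]. *)
pose i0 := Ordinal (ltnW hs); pose i1 := Ordinal hs.
have wedge_neq0 : wedge (delta_mx 0 i0) (delta_mx 0 i1) <> 0 :> 'M[R]_s.
  move=> w0; have := mulmx_wedge (delta_mx 0 i0) (delta_mx 0 i0 : 'rV[R]_s) (delta_mx 0 i1).
  rewrite w0 mulmx0 !dotp_e eqxx /= scale1r scale0r subr0 => /esym/eqP.
  by apply/negP; exact: e_neq0.
have perp_neq0 : perp (delta_mx 0 i0) <> 0 :> 'M[R]_s.
  move=> p0; have := mulmx_perp (delta_mx 0 i1) (delta_mx 0 i0 : 'rV[R]_s).
  rewrite p0 mulmx0 !dotp_e eqxx /= scale1r scale0r subr0 => /esym/eqP.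
  by apply/negP; exact: e_neq0.
have tt i j : gform (gF F P0) (tvec i) (tvec j) = - (i == j)%:R by exact: gform_tvec.
have uu i j c : gform (gF F P0) (uvec F P0 i c) (uvec F P0 j c) = c * (i == j)%:R.
  exact: gform_uvec.
split.
- split.
    move=> P MP x x' xx xx'.
    have x0 : ucoord x != 0 by apply: (@spacelike_ucoord_neq0 _ _ F P); rewrite xx.
    have x'0 : ucoord x' != 0 by apply: (@spacelike_ucoord_neq0 _ _ F P); rewrite xx'.
    have [B [-> aB _]] := JE P MP x; have [B' [-> aB' _]] := JE P MP x'.
    apply: similar_trans (nil3_perp_reduce x0 aB) _.
    apply: similar_trans (nil3_perp_similar x0 x'0) _.
    exact: similar_sym (nil3_perp_reduce x'0 aB').
  (* d/dt_0 has a vanishing Jacobi operator *)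
  move=> /(_ _ MP0 (tvec i0) (uvec F P0 i0 (-1))).
  rewrite tt uu eqxx mulr1 => /(_ erefl erefl).
  have [B [-> _]] := JE _ MP0 (tvec i0); have [B' [-> _ _]] := JE _ MP0 (uvec F P0 i0 (-1)).
  rewrite !coord_row => -> //.
  rewrite perp0 oppr0 nil3_0 => /similar0 /nil3_eq0[/eqP + _].
  by rewrite oppr_eq0 => /eqP.
- move=> P MP x y x' y' xy xy'; rewrite /same_jordan_form !WE//.
  have D := spacelike_onb_gram_det xy; have D' := spacelike_onb_gram_det xy'.
  apply: similar_trans (nil3_wedge_reduce _ _ D) _.
  apply: similar_trans (nil3_wedge_similar D D') _.
  exact: similar_sym (nil3_wedge_reduce _ _ D').
- split.
    (* the operator of the plane of d/dt_0 and d/dt_1 vanishes *)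
    move=> /(_ _ MP0 (tvec i0) (tvec i1) (uvec F P0 i0 (-1)) (uvec F P0 i1 (-1))).
    rewrite /timelike_onb !tt !uu !eqxx oppr0 mulr1 mulr0.
    move=> /(_ (And3 erefl erefl erefl) (And3 erefl erefl erefl)).
    rewrite /same_jordan_form !WE// !coord_row !wedge0l !wedge0r oppr0 addr0 nil3_0.
    by move=> /similar0 /nil3_eq0[+ _].
  have ut i : gform (gF F P0) (uvec F P0 i0 1) (tvec i) = 0 by exact: gform_uvec_tvec.
  have mixed i : mixed_basis (gF F) P0 (uvec F P0 i0 1) (tvec i) /\
      skew_weyl_mixed (gF F) P0 (uvec F P0 i0 1) (tvec i) =
      weyl_mx (gF F) P0 (uvec F P0 i0 1) (tvec i).
    by apply: mixed_basis_orthonormal; rewrite ?uu ?tt ?ut// eqxx ?mulr1.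
  (* the operator vanishes for d/dt_0 but not for d/dt_1, the corner block being
     a nonzero wedge product in the latter case *)
  move=> /(_ _ MP0 _ _ _ _ (mixed i0).1 (mixed i1).1).
  rewrite !(mixed _).2 /same_jordan_form !WE// !coord_row !wedge0l !wedge0r oppr0 !addr0.
  rewrite /wedge_partner !coord_row mul0mx scaler0 !(add0r, addr0) wedgexx nil3_0.
  by move=> /similar0 /nil3_eq0[_ /eqP]; rewrite wedgeC oppr_eq0 => /eqP.
Qed.
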